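(* Let $T$ be a tree with the following structure: $T$ contains an edge $uw$; the component of $T-uw$ containing $u$ is a tree $T_0$; the component of $T-uw$ containing $w$ is the union of a tree $T_1$ with $w\in V(T_1)$ and a path $P$ from $w$ to a vertex $v_0$ (a pendent path of $T$), where $V(T_1)\cap V(P)=\{w\}$. Assume that $0\le m(P)<\mathrm{ecc}_2(u,T_0)$ (if $m(P)=0$ then $v_0=w$). Let $T'$ be the tree obtained from $T$ by deleting all edges $wx$ with $x\in N_{T_1}(w)$ and adding all edges $uy$ with $y\in N_{T_1}(w)$. Let $P_0$ be a longest path starting at $u$ in $T_0$. If $\mathrm{ecc}_{T_0}(P_0)\le \mathrm{ecc}_2(w,P)<\mathrm{ecc}_2(u,T_0)$ and $\mathrm{ecc}_2(w,T_1)\le \mathrm{ecc}_2(w,P)$, then $\mathrm{aecc}_3(T')=\mathrm{aecc}_3(T)$. Otherwise, $\mathrm{aecc}_3(T')<\mathrm{aecc}_3(T)$.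
   Context: All graphs are simple and connected; $n(G)$ and $m(G)$ denote the order and the size of $G$. For $S\subseteq V(G)$, the Steiner distance $d_G(S)$ is the minimum size of a connected subgraph of $G$ containing $S$. For an integer $k\ge 2$ and $v\in V(G)$, the Steiner $k$-eccentricity is $\mathrm{ecc}_k(v,G)=\max\{d_G(S): v\in S\subseteq V(G), |S|=k\}$; $\mathrm{ecc}_2(v,G)$ is the usual eccentricity of $v$ (equal to $0$ if $G$ has a single vertex). The average Steiner $k$-eccentricity is $\mathrm{aecc}_k(G)=\frac{1}{n(G)}\sum_{v\in V(G)}\mathrm{ecc}_k(v,G)$. For a subgraph $H$ of $G$, $d_G(v,H)=\min\{d_G(v,h): h\in V(H)\}$ and $\mathrm{ecc}_G(H)=\max\{d_G(v,H): v\in V(G)\}$. $N_{T_1}(w)$ is the set of neighbours of $w$ in $T_1$. A pendent path is a path with one endpoint of degree $1$ all of whose internal vertices have degree $2$.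
   Formalization: The strict inequality in the ''otherwise'' case is stated only when T_1 has more than one vertex; if T_1 is the single vertex w then T' = T, so the averages are equal and the strict claim fails. *)

(* Defs.v *)
From mathcomp Require Import all_boot all_order all_algebra.
Set Implicit Arguments.
Unset Strict Implicit.
Unset Printing Implicit Defensive.

(* A graph living on vertices of V is a pair (vertex set, edge set), an edge
   being the set of its two ends.  All graphs of a statement share the ambient
   finite type V, so that subgraphs, unions and edge switches are set
   operations.  Raw pairs carry no invariant: is_graph is the wellformedness
   condition. *)
Notation graph V := ({set V} * {set {set V}})%type.

Section Graphs.
Variable V : finType.
Implicit Types (G H : graph V) (S A : {set V}) (x y v : V) (p : seq V).

Definition verts G : {set V} := G.1.
Definition edges G : {set {set V}} := G.2.
Definition order_of G : nat := #|verts G|.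
Definition size_of G : nat := #|edges G|.

Definition is_graph G : bool :=
  [forall f in edges G, (f \subset verts G) && (#|f| == 2)].

Definition adj G : rel V := fun x y => [set x; y] \in edges G.
Definition nbrs G x : {set V} := [set y | adj G x y].
Definition deg G x : nat := #|nbrs G x|.

Definition subgraph H G : bool :=
  [&& is_graph H, verts H \subset verts G & edges H \subset edges G].

Definition connected G : bool :=
  (verts G != set0) &&
  [forall x in verts G, forall y in verts G, connect (adj G) x y].

Definition acyclic G : Prop := forall c : seq V, 2 < size c -> ~ ucycle (adj G) c.

Definition is_tree G : Prop := [/\ is_graph G, connected G & acyclic G].

(* The value m(G) used as the neutral element is attained by H = G whenever
   G is connected and contains S. *)
Definition steiner_dist G S : nat :=
  \big[minn/size_of G]_(H : graph V |
      [&& subgraph H G, connected H & S \subset verts H]) size_of H.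

Definition ecc (k : nat) v G : nat :=
  \max_(S : {set V} | [&& v \in S, S \subset verts G & #|S| == k])
    steiner_dist G S.

Definition aecc (k : nat) G : rat :=
  ((\sum_(v in verts G) ecc k v G)%:R / (order_of G)%:R)%R.

(* Length of a shortest walk from x to y; the neutral element n(G) is only
   reached when there is none. *)
Definition dist G x y : nat :=
  \big[minn/order_of G]_(k < order_of G |
      [exists p : k.-tuple V, path (adj G) x p && (last x p == y)]) k.

(* dist never exceeds the neutral element n(G). *)
Definition dist_to G v H : nat :=
  \big[minn/order_of G]_(h in verts H) dist G v h.

Definition ecc_sub G H : nat := \max_(v in verts G) dist_to G v H.

(* The path with successive vertices x :: p, so with size p edges. *)
Definition is_path G x p : bool :=
  [&& x \in verts G, path (adj G) x p & uniq (x :: p)].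

Definition path_graph x p : graph V :=
  ([set:: x :: p], [set:: [seq [set e.1; e.2] | e <- zip (x :: p) p]]).

(* behead (belast x p) lists the internal vertices of x :: p. *)
Definition is_pendent_path G x p : bool :=
  [&& is_path G x p, (deg G x == 1) || (deg G (last x p) == 1)
    & all (fun y => deg G y == 2) (behead (belast x p))].

Definition is_longest_path_from G x p : Prop :=
  is_path G x p /\ forall q, is_path G x q -> size q <= size p.

Definition gunion G H : graph V :=
  (verts G :|: verts H, edges G :|: edges H).

Definition del_edge G x y : graph V := (verts G, edges G :\ [set x; y]).

Definition component G x : graph V :=
  let C := [set y | connect (adj G) x y] in
  (C, [set f in edges G | f \subset C]).

Definition switch G (w u : V) A : graph V :=
  (verts G, (edges G :\: [set [set w; y] | y in A]) :|: [set [set u; y] | y in A]).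

End Graphs.

(* Main.v *)
(* Deleting the edge [uw] leaves [T0] on one side and [T1], [P] glued at [w] on
   the other; in [T'] it leaves [P] on one side and [T0], [T1] glued at [u] on
   the other.  Steiner distances add up along cut vertices, so those of a
   triple in [T] and in [T'] consist of the same contributions from [T0], [T1]
   and [P], and differ only in whether the triple pays for [uw].  Put
   [a = ecc_2(u,T0)], [b = m(P) < a], [c = ecc_2(w,T1)], [e0 = ecc_{T0}(P0)].

   A vertex of [T0] or of [T1] never gains eccentricity.  A vertex of [P] gains
   at most 1, and it gains only if some [x], [y] in [T1] have
   [d(w,x,y) > a + c]; then every vertex of [T0] loses 1, and [T0] has more
   vertices than [P].  If there is no gain: under the equality condition, every
   use of a vertex of [T1] in a maximal triple, or of a second vertex of [T0],
   can be replaced by [v0]; otherwise either [b < c] and [e0 <= c], and [u]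
   loses, or [b, c < e0], and every vertex of [T1] other than [w] loses.  The
   last case uses [max d(u,x,y) = a + e0] over [x], [y] in [T0]: the Steiner tree
   of three vertices can be grown greedily from a longest path. *)
Require Import Defs.
From mathcomp Require Import all_boot all_order all_algebra all_fingroup zify.
Set Implicit Arguments.
Unset Strict Implicit.
Unset Printing Implicit Defensive.

(** * Steiner distance and cut vertices *)

Section SteinerDistance.
Variable V : finType.
Implicit Types (G H A B : graph V) (S X : {set V}) (x y z v r : V) (p q : seq V).

Lemma bigminn_le_cond (I : finType) (m : nat) (Q : pred I) (F : I -> nat) j :
  Q j -> \big[minn/m]_(i | Q i) F i <= F j.
Proof.
move=> Qj; have: j \in index_enum I by rewrite mem_index_enum.
elim: (index_enum I) => // i s IH; rewrite inE big_cons => /orP[/eqP <-|/IH {}IH].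
  by rewrite Qj geq_minl.
by case: (Q i) => //; exact: leq_trans (geq_minr _ _) IH.
Qed.

(** The bound [F j <= m] prevents the neutral element [m] from undercutting all values. This
    disposes of the default values in [steiner_dist], [dist] and [dist_to]. *)
Lemma bigminn_attained (I : finType) (m : nat) (Q : pred I) (F : I -> nat) j :
  Q j -> F j <= m -> exists2 i, Q i & \big[minn/m]_(i | Q i) F i = F i.
Proof.
move=> Qj Fj; have le := bigminn_le_cond m F Qj.
have [E|//]: \big[minn/m]_(i | Q i) F i = m \/
    exists2 i, Q i & \big[minn/m]_(i | Q i) F i = F i.
  elim/big_ind: _ => [|a b [->|[i Qi ->]] [->|[k Qk ->]]|i Qi]; first by left.
  - by left; rewrite minnn.
  - by case: (leqP m (F k)) => ?; [left|right; exists k].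
  - by case: (leqP (F i) m) => ?; [right; exists i|left].
  - by right; case: (leqP (F i) (F k)) => ?; [exists i|exists k].
  - by right; exists i.
by exists j => //; apply/eqP; rewrite eqn_leq le E.
Qed.

Lemma graph_edgeE G e : is_graph G -> e \in edges G ->
  exists x y, [/\ e = [set x; y], x != y, x \in verts G & y \in verts G].
Proof.
move=> /forall_inP gG /gG /andP[/subsetP sub /cards2P[x [y [xy E]]]].
by exists x, y; split=> //; apply: sub; rewrite E !inE eqxx ?orbT.
Qed.

Lemma is_graphP G :
  (forall e, e \in edges G -> exists x y, [/\ e = [set x; y], x != y, x \in verts G & y \in verts G]) ->
  is_graph G.
Proof.
move=> gG; apply/forall_inP => e /gG[x [y [-> xy xG yG]]].
by rewrite cards2 xy subUset !sub1set xG yG.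
Qed.

Lemma adj_sym G : symmetric (adj G).
Proof. by move=> x y; rewrite /adj setUC. Qed.

Lemma adj_verts G x y : is_graph G -> adj G x y ->
  [/\ x != y, x \in verts G & y \in verts G].
Proof.
move=> /forall_inP gG /gG /andP[]; rewrite subUset !sub1set cards2.
by case/andP => -> ->; case: (x != y).
Qed.

Lemma connect_adjC G : connect_sym (adj G).
Proof. by apply: sym_connect_sym; exact: adj_sym. Qed.

Lemma connect_sub_edges G H x y : edges H \subset edges G ->
  connect (adj H) x y -> connect (adj G) x y.
Proof.
move=> /subsetP sub; apply: connect_sub => a b ab.
by apply: connect1; exact: sub.
Qed.

Lemma connectedP G : reflect
  ((exists x, x \in verts G) /\ {in verts G &, forall x y, connect (adj G) x y})
  (connected G).
Proof.
apply: (iffP andP) => [[/set0Pn ne /forall_inP c]|[/set0Pn ne c]]; split=> //.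
  by move=> x y xG yG; move/forall_inP: (c x xG) => /(_ y yG).
by apply/forall_inP => x xG; apply/forall_inP => y yG; exact: c.
Qed.

Lemma connected_from G r : r \in verts G ->
  {in verts G, forall x, connect (adj G) r x} -> connected G.
Proof.
move=> rG c; apply/connectedP; split; first by exists r.
move=> x y xG yG; apply: connect_trans (c y yG).
by rewrite connect_adjC c.
Qed.

Lemma gunionC G H : gunion G H = gunion H G.
Proof. by rewrite /gunion setUC (setUC (edges G)). Qed.

Lemma is_graph_gunion G H : is_graph G -> is_graph H -> is_graph (gunion G H).
Proof.
move=> gG gH; apply: is_graphP => e; rewrite inE => /orP[/(graph_edgeE gG)|/(graph_edgeE gH)];
by move=> [x [y [E xy xG yG]]]; exists x, y; split=> //; rewrite inE ?xG ?yG ?orbT.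
Qed.

Lemma connected_gunion G H x : x \in verts G -> x \in verts H ->
  connected G -> connected H -> connected (gunion G H).
Proof.
move=> xG xH /connectedP[_ cG] /connectedP[_ cH].
apply: (@connected_from _ x) => [|y]; first by rewrite inE xG.
rewrite inE => /orP[/(cG x y xG)|/(cH x y xH)]; apply: connect_sub_edges;
  [exact: subsetUl|exact: subsetUr].
Qed.

Lemma subgraphP G H : reflect
  [/\ is_graph H, {subset verts H <= verts G} & {subset edges H <= edges G}]
  (subgraph H G).
Proof.
apply: (iffP and3P) => [[? /subsetP ? /subsetP ?]|[? ? ?]]; split=> //; exact/subsetP.
Qed.

Lemma subgraph_refl G : is_graph G -> subgraph G G.
Proof. by move=> gG; apply/subgraphP; split. Qed.

Lemma subgraph_trans A G H : subgraph H A -> subgraph A G -> subgraph H G.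
Proof.
move=> /subgraphP[gH vH eH] /subgraphP[_ vA eA].
by apply/subgraphP; split=> // ? ?; [apply/vA/vH|apply/eA/eH].
Qed.

Lemma subgraph_gunion G H A : subgraph H G -> subgraph A G -> subgraph (gunion H A) G.
Proof.
move=> /subgraphP[gH vH eH] /subgraphP[gA vA eA].
apply/subgraphP; split; first exact: is_graph_gunion.
  by move=> x; rewrite inE => /orP[/vH|/vA].
by move=> x; rewrite inE => /orP[/eH|/eA].
Qed.

Lemma subgraph_gunionl G H : is_graph G -> subgraph G (gunion G H).
Proof. by move=> gG; apply/subgraphP; split=> // x xG; rewrite inE xG. Qed.

Lemma size_gunion G H : size_of (gunion G H) <= size_of G + size_of H.
Proof. by rewrite /size_of cardsU leq_subr. Qed.

Lemma steiner_le G H S : subgraph H G -> connected H -> S \subset verts H ->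
  steiner_dist G S <= size_of H.
Proof. by move=> sH cH SH; apply: bigminn_le_cond; rewrite sH cH. Qed.

Lemma steiner_attained G S : is_graph G -> connected G -> S \subset verts G ->
  exists H, [/\ subgraph H G, connected H, S \subset verts H
              & size_of H = steiner_dist G S].
Proof.
move=> gG cG SG; rewrite /steiner_dist.
have [|//|H /and3P[sH cH SH] ->] := @bigminn_attained _ (size_of G)
  (fun H : graph V => [&& subgraph H G, connected H & S \subset verts H]) (@size_of V) G.
  by rewrite subgraph_refl // cG.
by exists H.
Qed.

Lemma steiner_mono G S X : is_graph G -> connected G -> X \subset verts G ->
  S \subset X -> steiner_dist G S <= steiner_dist G X.
Proof.
move=> gG cG XG SX; have [H [sH cH XH <-]] := steiner_attained gG cG XG.
by apply: steiner_le => //; exact: subset_trans XH.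
Qed.

(** Optimal subgraphs for [S] and [X] share the vertex [x], so their union is connected. *)
Lemma steinerU G S X x : is_graph G -> connected G ->
  S \subset verts G -> X \subset verts G -> x \in S -> x \in X ->
  steiner_dist G (S :|: X) <= steiner_dist G S + steiner_dist G X.
Proof.
move=> gG cG SG XG xS xX.
have [H [sH cH SH <-]] := steiner_attained gG cG SG.
have [K [sK cK XK <-]] := steiner_attained gG cG XG.
apply: leq_trans (size_gunion H K); apply: steiner_le.
- exact: subgraph_gunion.
- by apply: (@connected_gunion _ _ x) => //; [exact: (subsetP SH)|exact: (subsetP XK)].
- exact: setUSS.
Qed.

Definition vertex_graph x : graph V := ([set x], set0).

Lemma vertex_graph_connected x : connected (vertex_graph x).
Proof. by apply: (@connected_from _ x) => [|y]; rewrite inE // => /eqP ->. Qed.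

Lemma vertex_subgraph G x : x \in verts G -> subgraph (vertex_graph x) G.
Proof.
move=> xG; apply/subgraphP; split=> [|y /set1P-> //|y]; last by rewrite inE.
by apply: is_graphP => e; rewrite inE.
Qed.

Lemma steiner_set1 G x : x \in verts G -> steiner_dist G [set x] = 0.
Proof.
move=> xG; apply/eqP; rewrite -leqn0.
have := steiner_le (vertex_subgraph xG) (vertex_graph_connected x) (subxx _).
by rewrite /size_of cards0.
Qed.

Definition edge_graph x y : graph V := ([set x; y], [set [set x; y]]).

Lemma edge_graph_graph x y : x != y -> is_graph (edge_graph x y).
Proof.
move=> xy; apply: is_graphP => e /set1P ->; exists x, y.
by rewrite /= !inE !eqxx orbT.
Qed.

Lemma edge_graph_connected x y : connected (edge_graph x y).
Proof.
apply: (@connected_from _ x) => [|z]; rewrite !inE ?eqxx // => /orP[] /eqP -> //.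
by apply: connect1; rewrite /adj set11.
Qed.

Lemma steiner_edge_graph x y : x != y -> steiner_dist (edge_graph x y) [set x; y] = 1.
Proof.
move=> xy; have gK := edge_graph_graph xy; have cK := edge_graph_connected x y.
apply/eqP; rewrite eqn_leq; apply/andP; split.
  by rewrite (leq_trans (steiner_le (subgraph_refl gK) cK (subxx _))) // /size_of cards1.
have [H [/subgraphP[_ _ eH] /connectedP[_ cH] SH <-]] := steiner_attained gK cK (subxx _).
rewrite lt0n cards_eq0; apply/negP => /eqP H0.
have /connectP[[_ /= E|z q /= /andP[]]] : connect (adj H) x y.
- by apply: cH; apply: (subsetP SH); rewrite !inE eqxx ?orbT.
- by rewrite E eqxx in xy.
- by rewrite /adj H0 inE.
Qed.

(* Collapsing [B] to the cut vertex [r] retracts [A + B] onto [A], so a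
   connected subgraph meets [A] in a connected subgraph. *)
Definition glued A B r : Prop :=
  [/\ is_graph A, is_graph B, connected A, connected B & verts A :&: verts B = [set r]].

Definition grestr G A : graph V := (verts G :&: verts A, edges G :&: edges A).

Lemma gluedC A B r : glued A B r -> glued B A r.
Proof. by case=> *; split=> //; rewrite setIC. Qed.

Lemma glued_vert A B r (g : glued A B r) x : (x \in verts A) && (x \in verts B) = (x == r).
Proof. by case: g => _ _ _ _ /setP/(_ x); rewrite !inE. Qed.

Lemma glued_root A B r : glued A B r -> r \in verts A /\ r \in verts B.
Proof. by move=> /glued_vert /(_ r); rewrite eqxx => /andP. Qed.

Lemma glued_is_graph A B r : glued A B r -> is_graph (gunion A B).
Proof. by case=> *; exact: is_graph_gunion. Qed.

Lemma glued_connected A B r : glued A B r -> connected (gunion A B).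
Proof. by move=> g; case: (glued_root g) => rA rB; case: g => *; exact: connected_gunion rA rB _ _. Qed.

(** A common edge would have both of its distinct ends in the one-vertex intersection. *)
Lemma glued_edges_disjoint A B r : glued A B r -> [disjoint edges A & edges B].
Proof.
move=> g; apply/pred0P => e /=; apply/negP => /andP[eA eB].
have [gA gB _ _ _] := g.
have [x [y [E xy xA yA]]] := graph_edgeE gA eA.
move/forall_inP: gB => /(_ e eB); rewrite E subUset !sub1set => /andP[/andP[xB yB] _].
have := glued_vert g x; have := glued_vert g y.
by rewrite xA xB yA yB => /esym/eqP Ey /esym/eqP Ex; rewrite Ex Ey eqxx in xy.
Qed.

(** Induction along a walk of [H], whose image under the retraction is followed: an edge of [A] is
    kept, an edge of [B] shrinks to [r]. *)
Lemma glued_connect_restr A B r H x y : glued A B r -> subgraph H (gunion A B) ->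
  connect (adj H) x y -> x \in verts A ->
  connect (adj (grestr H A)) x (if y \in verts A then y else r).
Proof.
move=> g /subgraphP[gH vH eH] /connectP[q]; elim/last_ind: q y => [|q z IH] y.
  by move=> _ -> xA; rewrite xA.
rewrite rcons_path last_rcons => /andP[/IH {}IH qz] -> xA.
have {IH} := IH _ erefl xA; set l := last x q in qz *.
have [gA gB _ _ _] := g; have [rA rB] := glued_root g.
have := eH _ qz; rewrite inE => /orP[] e.
  have [_ lA zA] := adj_verts gA e; rewrite lA zA => c; apply: connect_trans c _.
  by apply: connect1; apply/setIP.
have [_ lB zB] := adj_verts gB e.
have R t : t \in verts B -> (if t \in verts A then t else r) = r.
  by move=> tB; case: ifP => // tA; apply/eqP; rewrite -(glued_vert g t) tA tB.
by rewrite !R.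
Qed.

Lemma glued_restr A B r H x : glued A B r -> subgraph H (gunion A B) -> connected H ->
  x \in verts H -> x \in verts A ->
  subgraph (grestr H A) A /\ connected (grestr H A).
Proof.
move=> g sH cH xH xA; have [gA _ _ _ _] := g; split.
  have /subgraphP[gH _ _] := sH.
  apply/subgraphP; split=> [|y|y]; rewrite ?inE; try by case/andP.
  apply: is_graphP => e; rewrite inE => /andP[eH eA].
  have [y [z [E yz yH zH]]] := graph_edgeE gH eH.
  exists y, z; rewrite !inE yH zH; move/forall_inP: gA => /(_ e eA).
  by rewrite E subUset !sub1set => /andP[/andP[-> ->] _].
apply: (@connected_from _ x) => [|y]; first by rewrite inE xH.
rewrite inE => /andP[yH yA]; have := glued_connect_restr (y := y) g sH _ xA.
by rewrite yA; apply; move/connectedP: cH => [_ cH]; exact: cH.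
Qed.

(** The retracted walk from [x] ends at [r]. Either it is empty and [x = r], or its last edge
    belongs to [H] and brings [r] along. *)
Lemma glued_cut A B r H x y : glued A B r -> subgraph H (gunion A B) -> connected H ->
  x \in verts H -> x \in verts A -> y \in verts H -> y \notin verts A -> r \in verts H.
Proof.
move=> g sH /connectedP[_ cH] xH xA yH yA.
have := glued_connect_restr (y := y) g sH (cH _ _ xH yH) xA.
rewrite (negbTE yA) => /connectP[q]; case/lastP: q => [_ -> //|q z].
rewrite rcons_path last_rcons => /andP[_ /setIP[qz _]] ->.
by have /subgraphP[gH _ _] := sH; have [] := adj_verts gH qz.
Qed.

(** Restricting an optimal subgraph to [A] keeps it connected and adds no edge. *)
Lemma steiner_glued_in A B r S : glued A B r -> S != set0 -> S \subset verts A ->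
  steiner_dist (gunion A B) S = steiner_dist A S.
Proof.
move=> g /set0Pn[x xS] SA; have [gA gB cA cB _] := g.
have gG := glued_is_graph g; have cG := glued_connected g.
have SG : S \subset verts (gunion A B) by apply: subset_trans SA _; exact: subsetUl.
apply/eqP; rewrite eqn_leq; apply/andP; split.
  have [H [sH cH SH <-]] := steiner_attained gA cA SA.
  by apply: steiner_le => //; apply: subgraph_trans sH _; exact: subgraph_gunionl.
have [H [sH cH SH <-]] := steiner_attained gG cG SG.
have [sR cR] := glued_restr g sH cH (subsetP SH x xS) (subsetP SA x xS).
apply: leq_trans (steiner_le sR cR _) _; first by rewrite subsetI SH.
by apply: subset_leq_card; exact: subsetIl.
Qed.

(** Optimal subgraphs of the two sides join at [r]; conversely an optimal subgraph of the whole
    restricts to both sides, and the restrictions have no edge in common. *)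
Lemma steiner_glued_root A B r S : glued A B r -> S \subset verts (gunion A B) -> r \in S ->
  steiner_dist (gunion A B) S =
  steiner_dist A (S :&: verts A) + steiner_dist B (S :&: verts B).
Proof.
move=> g SG rS; have [gA gB cA cB _] := g.
have gG := glued_is_graph g; have cG := glued_connected g; have [rA rB] := glued_root g.
apply/eqP; rewrite eqn_leq; apply/andP; split.
  have [H [sH cH SH <-]] := steiner_attained gA cA (subsetIr S _).
  have [K [sK cK SK <-]] := steiner_attained gB cB (subsetIr S _).
  apply: leq_trans (size_gunion H K); apply: steiner_le.
  - apply: subgraph_gunion.
      by apply: subgraph_trans sH _; exact: subgraph_gunionl.
    by apply: subgraph_trans sK _; rewrite gunionC; exact: subgraph_gunionl.
  - by apply: (@connected_gunion _ _ r) => //; [apply: (subsetP SH)|apply: (subsetP SK)]; rewrite inE rS.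
  - apply/subsetP => x xS; move: (subsetP SG x xS); rewrite !inE => /orP[] xA.
      by rewrite (subsetP SH) // inE xS.
    by rewrite (subsetP SK) ?orbT // inE xS.
have [H [sH cH SH <-]] := steiner_attained gG cG SG.
have rH := subsetP SH _ rS.
have [sR cR] := glued_restr g sH cH rH rA.
have [|sL cL] := glued_restr (gluedC g) _ cH rH rB; first by rewrite gunionC.
apply: leq_trans (leq_add (steiner_le sR cR _) (steiner_le sL cL _)) _; rewrite ?setSI //.
have disj : edges (grestr H A) :&: edges (grestr H B) = set0.
  apply/setP => e; rewrite !inE; have /pred0P/(_ e) /= := glued_edges_disjoint g.
  by case: (e \in edges A); case: (e \in edges B); rewrite ?andbF.
rewrite /size_of -cardsUI disj cards0 addn0.
by apply: subset_leq_card; rewrite subUset !subsetIl.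
Qed.

(** A connected subgraph with vertices strictly on both sides already passes through the cut
    vertex. *)
Lemma steiner_glued_cross A B r S : glued A B r -> S \subset verts (gunion A B) ->
  ~~ (S \subset verts A) -> ~~ (S \subset verts B) ->
  steiner_dist (gunion A B) S = steiner_dist (gunion A B) (r |: S).
Proof.
move=> g SG /subsetPn[y yS yA] /subsetPn[x xS xB].
have gG := glued_is_graph g; have cG := glued_connected g; have [rA rB] := glued_root g.
apply/eqP; rewrite eqn_leq; apply/andP; split.
  by apply: steiner_mono; rewrite ?subsetUr // subUset sub1set SG inE rA.
have [H [sH cH SH <-]] := steiner_attained gG cG SG.
apply: steiner_le => //; rewrite subUset sub1set SH andbT.
have xA : x \in verts A by have := subsetP SG x xS; rewrite inE (negbTE xB) orbF.
by apply: (glued_cut (x := x) (y := y) g sH cH) => //; exact: (subsetP SH).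
Qed.

End SteinerDistance.

(** * Steiner distances of triples *)

Section Triples.
Variable V : finType.
Implicit Types (G H A B X Y Z : graph V) (S : {set V}) (x y z v r s : V).

(** Repetitions are allowed, so [steiner3 G r x x] serves as the distance from [r] to [x], and
    eccentricities for [k = 2] and [k = 3] are treated uniformly. *)
Definition steiner3 G x y z : nat := steiner_dist G [set x; y; z].

Lemma steiner3C12 G x y z : steiner3 G x y z = steiner3 G y x z.
Proof. by rewrite /steiner3 (setUC [set x]). Qed.

Lemma steiner3C23 G x y z : steiner3 G x y z = steiner3 G x z y.
Proof. by rewrite /steiner3 setUAC. Qed.

Lemma steiner3C13 G x y z : steiner3 G x y z = steiner3 G z y x.
Proof. by rewrite steiner3C23 steiner3C12 steiner3C23. Qed.

Lemma exists_superset_card S1 S2 (k : nat) : S1 \subset S2 -> #|S1| <= k <= #|S2| ->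
  exists S, [/\ S1 \subset S, S \subset S2 & #|S| = k].
Proof.
move=> sub /andP[lk ku]; elim: k lk ku => [|k IH] lk ku.
  by exists S1; split=> //; apply/eqP; rewrite -leqn0.
move: lk; rewrite leq_eqVlt => /orP[/eqP E|lk]; first by exists S1.
have [S [SS1 SS2 kS]] := IH lk (ltnW ku).
have /properP[_ [x xS2 xS]] : S \proper S2 by rewrite properEcard SS2 kS.
exists (x |: S); rewrite cardsU1 xS kS; split=> //; first exact: subset_trans SS1 (subsetUr _ _).
by rewrite subUset sub1set xS2.
Qed.

(** A set with fewer than [k] elements can be padded without lowering its Steiner distance; this
    admits triples with repeated vertices. *)
Lemma steiner_le_ecc (k : nat) G v S : is_graph G -> connected G -> v \in S ->
  S \subset verts G -> #|S| <= k <= order_of G -> steiner_dist G S <= ecc k v G.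
Proof.
move=> gG cG vS SG kS; have [X [SX XG kX]] := exists_superset_card SG kS.
apply: leq_trans (steiner_mono gG cG XG SX) _.
rewrite /ecc (bigD1 X) ?leq_maxl //= (subsetP SX v vS) XG kX eqxx //.
Qed.

Lemma ecc_attained (k : nat) G v : v \in verts G -> 0 < k <= order_of G ->
  exists S, [/\ v \in S, S \subset verts G, #|S| = k & ecc k v G = steiner_dist G S].
Proof.
move=> vG /andP[k0 kG].
have [||X [vX XG kX]] := @exists_superset_card [set v] (verts G) k.
- by rewrite sub1set.
- by rewrite cards1 k0.
have [|S /and3P[vS SG /eqP kS] E] := @eq_bigmax_cond _
  [pred S : {set V} | [&& v \in S, S \subset verts G & #|S| == k]] (steiner_dist G).
  by apply/card_gt0P; exists X; rewrite unfold_in -sub1set vX XG kX /=.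
by exists S; split=> //; rewrite -E.
Qed.

Lemma steiner3_le_ecc3 G v x y : is_graph G -> connected G -> 2 < order_of G ->
  v \in verts G -> x \in verts G -> y \in verts G -> steiner3 G v x y <= ecc 3 v G.
Proof.
move=> gG cG n3 vG xG yG; apply: steiner_le_ecc => //.
- by rewrite !inE eqxx.
- by rewrite !subUset !sub1set vG xG yG.
by rewrite n3 andbT setUC cardsU1 cards2; case: (_ \notin _); case: (_ != _).
Qed.

Lemma ecc3_attained G v : 2 < order_of G -> v \in verts G ->
  exists x y, [/\ x \in verts G, y \in verts G & ecc 3 v G = steiner3 G v x y].
Proof.
move=> n3 vG; have [S [vS SG kS E]] := ecc_attained (k := 3) vG n3.
have /cards2P[x [y [xy SE]]] : #|S :\ v| == 2.
  by have := cardsD1 v S; rewrite vS kS; lia.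
move/subsetP: SG => SG; have sub t : t \in S :\ v -> t \in verts G by move=> /setD1P[_ /SG].
exists x, y; split; try by apply: sub; rewrite SE !inE eqxx ?orbT.
by rewrite E /steiner3 -setUA -SE setD1K.
Qed.

Lemma steiner3_le_ecc2 G v x : is_graph G -> connected G ->
  v \in verts G -> x \in verts G -> steiner3 G v x x <= ecc 2 v G.
Proof.
move=> gG cG vG xG; rewrite /steiner3 -setUA setUid.
have [<-|vx] := eqVneq v x; first by rewrite setUid steiner_set1.
have sub : [set v; x] \subset verts G by rewrite !subUset !sub1set vG xG.
apply: steiner_le_ecc => //; first by rewrite !inE eqxx.
by have := subset_leq_card sub; rewrite cards2 vx.
Qed.

Lemma ecc2_attained G v : is_graph G -> v \in verts G ->
  exists2 x, x \in verts G & ecc 2 v G = steiner3 G v x x.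
Proof.
move=> gG vG; have [n2|n2] := leqP 2 (order_of G).
  have [S [vS SG kS E]] := ecc_attained (k := 2) vG n2.
  have /cards1P[x SE] : #|S :\ v| == 1.
    by have := cardsD1 v S; rewrite vS kS; lia.
  exists x; first by have /setD1P[_ /(subsetP SG)] : x \in S :\ v by rewrite SE inE.
  by rewrite E /steiner3 -setUA setUid -SE setD1K.
(* With a single vertex there is no set of size 2: the maximum is the empty one, 0, and the constant
   triple attains it. *)
exists v => //; rewrite /steiner3 !setUid steiner_set1 //.
apply: big1 => S /and3P[_ /subset_leq_card kS /eqP E].
by move: n2; rewrite ltnNge -E kS.
Qed.

(* [T] has this shape with [X] = [T0] and [T'] has it with [X] = [P]. *)
Definition bridged X r Y Z s : graph V :=
  gunion (gunion X (edge_graph r s)) (gunion Y Z).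

Definition bridgeable X r Y Z s : Prop :=
  [/\ is_graph X, connected X, r \in verts X, glued Y Z s
    & [disjoint verts X & verts Y :|: verts Z]].

Lemma bridgeableC X r Y Z s : bridgeable X r Y Z s -> bridgeable X r Z Y s.
Proof. by case=> ? ? ? ? ?; split=> //; [exact: gluedC|rewrite setUC]. Qed.

Lemma bridgedC X r Y Z s : bridged X r Y Z s = bridged X r Z Y s.
Proof. by rewrite /bridged (gunionC Y). Qed.

(** * Steiner distances in three pieces around a bridge *)

Section Bridged.
Variables (X : graph V) (r : V) (Y Z : graph V) (s : V).
Hypothesis br : bridgeable X r Y Z s.
Let G := bridged X r Y Z s.
Let W := verts Y :|: verts Z.

Let rX : r \in verts X. Proof. by case: br. Qed.
Let gYZ : glued Y Z s. Proof. by case: br. Qed.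
Let sY : s \in verts Y. Proof. by case: (glued_root gYZ). Qed.
Let sZ : s \in verts Z. Proof. by case: (glued_root gYZ). Qed.
Let XW x : x \in verts X -> x \notin W.
Proof. by move=> xX; case: br => _ _ _ _ d; rewrite (disjointFr d). Qed.
Let rs : r != s.
Proof. by apply: contra (XW rX) => /eqP ->; rewrite inE sY. Qed.

Lemma glued_bridge : glued X (edge_graph r s) r.
Proof.
case: br => gX cX _ _ _; split=> //; [exact: edge_graph_graph|exact: edge_graph_connected|].
apply/setP => x; rewrite !inE; have [->|xr] := eqVneq x r; first by rewrite rX.
have [->|] := eqVneq x s; last by rewrite andbF.
by rewrite andbT; apply/negP => /XW; rewrite inE sY.
Qed.

Lemma glued_bridged : glued (gunion X (edge_graph r s)) (gunion Y Z) s.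
Proof.
split; try solve [exact: glued_is_graph glued_bridge|exact: glued_is_graph gYZ
  |exact: glued_connected glued_bridge|exact: glued_connected gYZ].
apply/setP => x; rewrite 2!inE [x \in verts (gunion Y Z)](_ : _ = (x \in W)) // !inE.
have [->|xs] := eqVneq x s; first by rewrite sY !orbT.
have [xX|xX] := boolP (x \in verts X); first by rewrite -in_setU (negbTE (XW xX)).
have [->|] := eqVneq x r; last by [].
by rewrite -in_setU (negbTE (XW rX)).
Qed.

Lemma bridged_is_graph : is_graph G. Proof. exact: glued_is_graph glued_bridged. Qed.
Lemma bridged_connected : connected G. Proof. exact: glued_connected glued_bridged. Qed.

Lemma verts_bridged x :
  (x \in verts G) = [|| x \in verts X, x \in verts Y | x \in verts Z].
Proof.
rewrite !inE; have [->|xr] := eqVneq x r; first by rewrite rX.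
by have [->|xs] := eqVneq x s; rewrite ?sY ?orbT ?orbF.
Qed.

Lemma steiner_bridged_X S : S != set0 -> S \subset verts X ->
  steiner_dist G S = steiner_dist X S.
Proof.
move=> ne SX; rewrite (steiner_glued_in glued_bridged) ?(steiner_glued_in glued_bridge) //.
by apply: subset_trans SX _; exact: subsetUl.
Qed.

Lemma steiner_bridged_YZ S : S != set0 -> S \subset W ->
  steiner_dist G S = steiner_dist (gunion Y Z) S.
Proof.
by move=> ne SW; rewrite /G /bridged gunionC (steiner_glued_in (gluedC glued_bridged)).
Qed.

Lemma steiner_bridged_Y S : S != set0 -> S \subset verts Y ->
  steiner_dist G S = steiner_dist Y S.
Proof.
move=> ne SY; rewrite steiner_bridged_YZ ?(steiner_glued_in gYZ) //.
by apply: subset_trans SY _; exact: subsetUl.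
Qed.

(** Either [s] is in [S], or [S] meets both sides strictly and crosses [s]; in both cases [s] can be
    added for free before splitting there. *)
Lemma steiner_bridged_YZ_split S y z : S \subset W ->
  y \in S -> y \in verts Y -> y != s -> z \in S -> z \in verts Z ->
  steiner_dist G S = steiner_dist Y (s |: S :&: verts Y) + steiner_dist Z (s |: S :&: verts Z).
Proof.
move=> SW yS yY ys zS zZ; rewrite steiner_bridged_YZ //; last by apply/set0Pn; exists y.
have -> : steiner_dist (gunion Y Z) S = steiner_dist (gunion Y Z) (s |: S).
  have [sS|sS] := boolP (s \in S); first by rewrite (setUidPr _) // sub1set.
  apply: (steiner_glued_cross gYZ) => //.
    apply/subsetPn; exists z => //; apply: contra sS => zY.
    by have := glued_vert gYZ z; rewrite zY zZ => /esym/eqP <-.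
  by apply/subsetPn; exists y => //; apply: contra ys => yZ; rewrite -(glued_vert gYZ) yY.
rewrite (steiner_glued_root gYZ) ?setU11 //; last first.
  by rewrite subUset sub1set (SW : S \subset verts (gunion Y Z)) andbT inE sY.
by rewrite !setIUl !(setIidPl (_ : [set s] \subset _)) ?sub1set.
Qed.

(** Both ends of the bridge are cut vertices crossed by [S]. They are added for free, first [s],
    then [r], and the distance splits at each; the successor counts the bridge. *)
Lemma steiner_bridged_split S x y : S \subset verts G ->
  x \in S -> x \in verts X -> y \in S -> y \in W ->
  steiner_dist G S = steiner_dist X (r |: S :&: verts X) +
    (steiner_dist Y (s |: S :&: verts Y) + steiner_dist Z (s |: S :&: verts Z)).+1.
Proof.
move=> SG xS xX yS yW.
set XK := gunion X (edge_graph r s).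
have -> : steiner_dist G S = steiner_dist G (s |: S).
  have [sS|sS] := boolP (s \in S); first by rewrite (setUidPr _) // sub1set.
  apply: (steiner_glued_cross glued_bridged) => //.
    apply/subsetPn; exists y => //; apply: contra sS => yK.
    by have := glued_vert glued_bridged y; rewrite yK [y \in _]yW => /esym/eqP <-.
  by apply/subsetPn; exists x => //; exact: XW.
have sSG : s |: S \subset verts G by rewrite subUset sub1set SG verts_bridged sY orbT.
rewrite (steiner_glued_root glued_bridged) ?setU11 //.
(* On the side of [X] the set now contains [s] and the vertex [x] of [X], so it also crosses [r]. *)
have -> : steiner_dist XK ((s |: S) :&: verts XK) = (steiner_dist X (r |: S :&: verts X)).+1.
  set S' := _ :&: _; have sS' : s \in S' by rewrite !inE eqxx ?orbT.
  have xS' : x \in S' by rewrite !inE xS xX ?orbT.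
  have -> : steiner_dist XK S' = steiner_dist XK (r |: S').
    have [rS|rS] := boolP (r \in S'); first by rewrite (setUidPr _) // sub1set.
    apply: (steiner_glued_cross glued_bridge); first exact: subsetIr.
      by apply/subsetPn; exists s => //; apply/negP => /XW; rewrite inE sY.
    apply/subsetPn; exists x => //; apply: contra rS => xK.
    by have := glued_vert glued_bridge x; rewrite xK xX => /esym/eqP <-.
  rewrite (steiner_glued_root glued_bridge) ?setU11 //; last first.
    by rewrite subUset sub1set subsetIr andbT !inE eqxx ?orbT.
  rewrite -[RHS]addn1 -[X in _ = _ + X](steiner_edge_graph rs).
  congr (_ + _); apply: congr1.
    apply/setP => t; rewrite !inE; have [->|tr] := eqVneq t r; first by rewrite rX.
    have [->|ts] := eqVneq t s; last by case: (t \in verts X); rewrite ?andbF ?andbT ?orbF.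
    by rewrite (_ : s \in verts X = false) ?andbF //; apply/negP => /XW; rewrite inE sY.
  apply/setP => t; rewrite !inE; have [->|tr] := eqVneq t r => //=.
  by have [->|ts] := eqVneq t s; rewrite ?andbT ?orbT ?andbF.
rewrite (steiner_glued_root gYZ) ?subsetIr //; last by rewrite !inE eqxx sY.
rewrite addSnnS; congr (_ + (_ + _).+1); apply: congr1.
  apply/setP => t; rewrite !inE; have [->|ts] := eqVneq t s; first by rewrite sY.
  by case: (t \in verts Y); rewrite ?andbF ?andbT.
apply/setP => t; rewrite !inE; have [->|ts] := eqVneq t s; first by rewrite sZ orbT.
by case: (t \in verts Z); rewrite ?andbF ?andbT ?orbT ?andbT.
Qed.

Let rootI t (A : {set V}) x y z : t |: ([set x; y; z] :&: A) =
  (t |: ([set x] :&: A)) :|: (t |: ([set y] :&: A)) :|: (t |: ([set z] :&: A)).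
Proof. by apply/setP => u; rewrite !inE; do !case: (_ == _); case: (_ \in _). Qed.

Let root_in t x (A : {set V}) : x \in A -> t |: ([set x] :&: A) = [set t; x].
Proof. by move=> xA; rewrite (setIidPl _) ?sub1set. Qed.

(** The implication lets [x] lie in [A] when it is the root itself, the one vertex shared by two
    glued pieces. *)
Let root_out t x (A : {set V}) : (x \in A) ==> (x == t) -> t |: ([set x] :&: A) = [set t].
Proof.
move=> xA; apply/setP => u; rewrite !inE; have [->|xu] := eqVneq u x; last by rewrite orbF.
by case: (x \in A) xA => /= [->|]; rewrite ?orbF.
Qed.

Let trisub x y z (A : {set V}) : x \in A -> y \in A -> z \in A -> [set x; y; z] \subset A.
Proof. by move=> *; rewrite !subUset !sub1set; apply/andP; split => //; apply/andP. Qed.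

Let mem3 x y z : [/\ x \in [set x; y; z], y \in [set x; y; z] & z \in [set x; y; z]].
Proof. by rewrite !inE !eqxx !orbT. Qed.

(** From here on, the letters in a name say which piece contains each vertex of the triple. The
    mixed cases instantiate the splitting lemmas, and [root_in], [root_out] compute the traces on
    the pieces. The remaining cases follow by permuting the triple or exchanging [Y] and [Z] through
    [bridgedC]. *)
Lemma steiner3_XXX x y z : x \in verts X -> y \in verts X -> z \in verts X ->
  steiner3 G x y z = steiner3 X x y z.
Proof.
by move=> *; apply: steiner_bridged_X; rewrite ?trisub //; apply/set0Pn; exists x; case: (mem3 x y z).
Qed.

Lemma steiner3_YYY x y z : x \in verts Y -> y \in verts Y -> z \in verts Y ->
  steiner3 G x y z = steiner3 Y x y z.
Proof.
by move=> *; apply: steiner_bridged_Y; rewrite ?trisub //; apply/set0Pn; exists x; case: (mem3 x y z).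
Qed.

Let outX y (A : {set V}) : y \in verts X -> A \subset W -> (y \in A) ==> (y == s).
Proof.
by move=> yX /subsetP sub; case: (boolP (y \in A)) => //= /sub yW; have := XW yX; rewrite yW.
Qed.

Let outY y : y \in W -> (y \in verts X) ==> (y == r).
Proof. by move=> yW; case: (boolP (y \in verts X)) => // /XW; rewrite yW. Qed.

Let outYZ y : y \in verts Y -> (y \in verts Z) ==> (y == s).
Proof. by move=> yY; rewrite -(glued_vert gYZ) yY; case: (_ \in _). Qed.

Let outZY y : y \in verts Z -> (y \in verts Y) ==> (y == s).
Proof. by move=> yY; rewrite -(glued_vert gYZ) yY; case: (_ \in _). Qed.

Let WY y : y \in verts Y -> y \in W. Proof. by rewrite inE => ->. Qed.
Let WZ y : y \in verts Z -> y \in W. Proof. by rewrite inE orbC => ->. Qed.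
Let GX y : y \in verts X -> y \in verts G. Proof. by rewrite verts_bridged => ->. Qed.
Let GW y : y \in W -> y \in verts G. Proof. by move=> yW; rewrite verts_bridged -in_setU yW orbT. Qed.

Lemma steiner3_YYZ y y' z : y \in verts Y -> y != s -> y' \in verts Y -> z \in verts Z ->
  steiner3 G y y' z = steiner3 Y s y y' + steiner3 Z s z z.
Proof.
move=> yY ys y'Y zZ; have [m1 m2 m3] := mem3 y y' z.
rewrite /steiner3 (steiner_bridged_YZ_split (trisub (WY yY) (WY y'Y) (WZ zZ)) m1 yY ys m3 zZ).
rewrite !rootI !(root_in s yY) !(root_in s y'Y) !(root_in s zZ).
rewrite (root_out (outZY zZ)) (root_out (outYZ yY)) (root_out (outYZ y'Y)).
by congr (_ + _); apply: congr1; apply/setP => t; rewrite !inE; do !case: (_ == _).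
Qed.

Lemma steiner3_YZZ y z z' : y \in verts Y -> y != s -> z \in verts Z -> z' \in verts Z ->
  steiner3 G y z z' = steiner3 Y s y y + steiner3 Z s z z'.
Proof.
move=> yY ys zZ z'Z; have [m1 m2 m3] := mem3 y z z'.
rewrite /steiner3 (steiner_bridged_YZ_split (trisub (WY yY) (WZ zZ) (WZ z'Z)) m1 yY ys m2 zZ).
rewrite !rootI !(root_in s yY) !(root_in s z'Z) !(root_in s zZ).
rewrite (root_out (outZY zZ)) (root_out (outYZ yY)) (root_out (outZY z'Z)).
by congr (_ + _); apply: congr1; apply/setP => t; rewrite !inE; do !case: (_ == _).
Qed.

Lemma steiner3_XYZ x y z : x \in verts X -> y \in verts Y -> z \in verts Z ->
  steiner3 G x y z = steiner3 X r x x + (steiner3 Y s y y + steiner3 Z s z z).+1.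
Proof.
move=> xX yY zZ; have [m1 m2 m3] := mem3 x y z.
rewrite /steiner3 (steiner_bridged_split (trisub (GX xX) (GW (WY yY)) (GW (WZ zZ))) m1 xX m2 (WY yY)).
rewrite !rootI !(root_in s yY) !(root_in r xX) !(root_in s zZ).
rewrite (root_out (outZY zZ)) (root_out (outYZ yY)).
rewrite (root_out (outY (WY yY))) (root_out (outY (WZ zZ)))
  (root_out (outX xX (subsetUl _ _))) (root_out (outX xX (subsetUr _ _))).
by congr (_ + (_ + _).+1); apply: congr1;
  apply/setP => t; rewrite !inE; do !case: (_ == _).
Qed.

Lemma steiner3_XXY x x' y : x \in verts X -> x' \in verts X -> y \in verts Y ->
  steiner3 G x x' y = steiner3 X r x x' + (steiner3 Y s y y).+1.
Proof.
move=> xX x'X yY; have [m1 m2 m3] := mem3 x x' y.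
rewrite /steiner3 (steiner_bridged_split (trisub (GX xX) (GX x'X) (GW (WY yY))) m1 xX m3 (WY yY)).
rewrite !rootI !(root_in s yY) !(root_in r xX) !(root_in r x'X).
rewrite (root_out (outYZ yY)).
rewrite (root_out (outY (WY yY)))
  (root_out (outX xX (subsetUl _ _))) (root_out (outX xX (subsetUr _ _))).
rewrite (root_out (outX x'X (subsetUl _ _))) (root_out (outX x'X (subsetUr _ _)))
  !setUid steiner_set1 // addn0.
by congr (_ + _.+1); apply: congr1;
  apply/setP => t; rewrite !inE; do !case: (_ == _).
Qed.

Lemma steiner3_XYY x y y' : x \in verts X -> y \in verts Y -> y' \in verts Y ->
  steiner3 G x y y' = steiner3 X r x x + (steiner3 Y s y y').+1.
Proof.
move=> xX yY y'Y; have [m1 m2 m3] := mem3 x y y'.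
rewrite /steiner3 (steiner_bridged_split (trisub (GX xX) (GW (WY yY)) (GW (WY y'Y))) m1 xX m2 (WY yY)).
rewrite !rootI !(root_in s yY) !(root_in r xX) !(root_in s y'Y).
rewrite (root_out (outYZ yY)) (root_out (outYZ y'Y)).
rewrite (root_out (outY (WY yY))) (root_out (outY (WY y'Y)))
  (root_out (outX xX (subsetUl _ _))) (root_out (outX xX (subsetUr _ _))).
rewrite
  !setUid steiner_set1 // addn0.
by congr (_ + _.+1); apply: congr1;
  apply/setP => t; rewrite !inE; do !case: (_ == _).
Qed.

End Bridged.

(** * Renaming vertices by a permutation *)

Section Relabel.
Implicit Type f : {perm V}.

(** The branch moved by the switch changes its root from [w] to [u]: it becomes its image under the
    transposition of these two vertices. *)
Definition relabel f G : graph V := (f @: verts G, [set f @: e | e : {set V} in edges G]).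

Lemma relabelK f G : relabel f^-1 (relabel f G) = G.
Proof.
have K (e : {set V}) : f^-1%g @: (f @: e) = e.
  by rewrite -imset_comp -[RHS]imset_id; apply: eq_imset => x; rewrite /= permK.
case: G => vG eG; rewrite /relabel /= K; congr pair.
by rewrite -imset_comp -[RHS]imset_id; apply: eq_imset => e; rewrite /= K.
Qed.

Lemma relabel_is_graph f G : is_graph G -> is_graph (relabel f G).
Proof.
move=> gG; apply: is_graphP => _ /imsetP[e /(graph_edgeE gG)[x [y [-> xy xG yG]]] ->].
exists (f x), (f y); rewrite imsetU !imset_set1 (inj_eq perm_inj).
by split=> //; exact: imset_f.
Qed.

Lemma relabel_connected f G : connected G -> connected (relabel f G).
Proof.
move=> /connectedP[[r rG] cG]; apply: (@connected_from _ _ (f r)); first exact: imset_f.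
move=> _ /imsetP[x xG ->]; have /connectP[q] := cG r x rG xG.
elim/last_ind: q x {xG} => [|q y IH] x; first by move=> _ ->.
rewrite rcons_path last_rcons => /andP[/IH {}IH qy] ->.
apply: connect_trans (IH _ erefl) (connect1 _).
by apply/imsetP; exists [set last r q; y]; rewrite // imsetU !imset_set1.
Qed.

Lemma relabel_subgraph f G H : subgraph H G -> subgraph (relabel f H) (relabel f G).
Proof.
move=> /and3P[gH vH eH].
by apply/and3P; split; [exact: relabel_is_graph|exact: imsetS|exact: imsetS].
Qed.

Lemma size_relabel f G : size_of (relabel f G) = size_of G.
Proof. by rewrite /size_of card_imset //; apply: imset_inj; exact: perm_inj. Qed.

Lemma steiner_relabel_le f G S : is_graph G -> connected G -> S \subset verts G ->
  steiner_dist (relabel f G) (f @: S) <= steiner_dist G S.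
Proof.
move=> gG cG SG; have [H [sH cH SH <-]] := steiner_attained gG cG SG.
rewrite -(size_relabel f); apply: steiner_le; [exact: relabel_subgraph
  |exact: relabel_connected|exact: imsetS].
Qed.

(** The inequality [steiner_relabel_le], applied to the inverse permutation as well. *)
Lemma steiner_relabel f G S : is_graph G -> connected G -> S \subset verts G ->
  steiner_dist (relabel f G) (f @: S) = steiner_dist G S.
Proof.
move=> gG cG SG; apply/eqP; rewrite eqn_leq steiner_relabel_le //=.
have := @steiner_relabel_le f^-1 (relabel f G) (f @: S).
rewrite relabelK -imset_comp (_ : (f^-1%g \o f) @: S = S); last first.
  by rewrite -[RHS]imset_id; apply: eq_imset => x; rewrite /= permK.
by apply; [exact: relabel_is_graph|exact: relabel_connected|exact: imsetS].
Qed.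

Lemma steiner3_relabel f G x y z : is_graph G -> connected G ->
  x \in verts G -> y \in verts G -> z \in verts G ->
  steiner3 (relabel f G) (f x) (f y) (f z) = steiner3 G x y z.
Proof.
move=> gG cG xG yG zG; rewrite /steiner3 -[RHS](steiner_relabel f) //.
  by rewrite !imsetU !imset_set1.
by rewrite !subUset !sub1set xG yG zG.
Qed.

End Relabel.
End Triples.

(** * Paths in acyclic graphs *)

Section Paths.
Variable V : finType.
Implicit Types (G H : graph V) (S : {set V}) (x y z u : V) (p q : seq V).

Lemma verts_path_graph x p y : (y \in verts (path_graph x p)) = (y \in x :: p).
Proof. by rewrite inE. Qed.

Lemma path_graph_cons x y p :
  path_graph x (y :: p) = gunion (edge_graph x y) (path_graph y p).
Proof.
have vE : [set:: [:: x, y & p]] = [set x; y] :|: [set:: y :: p].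
  by rewrite !set_cons -setUA (setUA [set y]) setUid.
have eE : edges (path_graph x (y :: p)) = [set x; y] |: edges (path_graph y p).
  exact: set_cons.
by rewrite /gunion -eE -vE.
Qed.

Lemma edge_path_graph_sub x p e : e \in edges (path_graph x p) ->
  {subset e <= x :: p}.
Proof.
elim: p x => [|y p IH] x; first by rewrite inE.
rewrite path_graph_cons inE => /orP[/set1P-> z|/IH sub z /sub]; rewrite !inE.
  by case/orP => ->; rewrite ?orbT.
by move=> ->; rewrite orbT.
Qed.

Lemma path_graph_is_graph x p : uniq (x :: p) -> is_graph (path_graph x p).
Proof.
elim: p x => [|y p IH] x; first by move=> _; apply: is_graphP => e; rewrite inE.
case/andP => xyp /IH g; rewrite path_graph_cons is_graph_gunion // edge_graph_graph //.
by apply: contra xyp => /eqP ->; rewrite mem_head.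
Qed.

Lemma path_graph_connected x p : connected (path_graph x p).
Proof.
elim: p x => [|y p IH] x.
  by apply: (@connected_from _ _ x) => [|y]; rewrite !inE // => /eqP ->.
rewrite path_graph_cons; apply: (@connected_gunion _ _ _ y) => //.
- by rewrite !inE eqxx orbT.
- by rewrite !inE eqxx.
- exact: edge_graph_connected.
Qed.

Lemma path_graph_edges_sub G x p : path (adj G) x p ->
  {subset edges (path_graph x p) <= edges G}.
Proof.
elim: p x => [|y p IH] x; first by move=> _ e; rewrite inE.
by case/andP => xy /IH sub e; rewrite path_graph_cons inE => /orP[/set1P-> //|/sub].
Qed.

Lemma path_verts G x p : is_graph G -> x \in verts G -> path (adj G) x p ->
  {subset x :: p <= verts G}.
Proof.
move=> gG; elim: p x => [|y p IH] x xG /=; first by move=> _ z; rewrite inE => /eqP ->.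
case/andP => /(adj_verts gG)[_ _ yG] /(IH _ yG) sub z.
by rewrite inE => /orP[/eqP ->|/sub].
Qed.

Lemma path_subgraph G x p : is_graph G -> is_path G x p -> subgraph (path_graph x p) G.
Proof.
move=> gG /and3P[xG xp up]; apply/subgraphP; split.
- exact: path_graph_is_graph.
- by move=> z; rewrite verts_path_graph; exact: path_verts.
- exact: path_graph_edges_sub.
Qed.

(** Distinct vertices give distinct edges: only the first edge contains [x]. *)
Lemma size_path_graph x p : uniq (x :: p) -> size_of (path_graph x p) = size p.
Proof.
elim: p x => [|y p IH] x; first by move=> _; rewrite /size_of /= cards0.
case/andP => xyp up; have nin : [set x; y] \notin edges (path_graph y p).
  by apply: contra xyp => /edge_path_graph_sub; apply; rewrite !inE eqxx.
by rewrite path_graph_cons /size_of cardsU1 nin [#|_|]IH.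
Qed.

Lemma walk_is_path G x p : x \in verts G -> path (adj G) x p ->
  exists q, [/\ is_path G x q, last x q = last x p & size q <= size p].
Proof.
move=> xG xp; case/shortenP: xp => q xq uq sub; exists q; split=> //.
  by rewrite /is_path xG xq.
by apply: uniq_leq_size sub; case/andP: uq.
Qed.

Lemma connected_is_path G x y : connected G -> x \in verts G -> y \in verts G ->
  exists2 p, is_path G x p & last x p = y.
Proof.
move=> /connectedP[_ cG] xG yG; have /connectP[p xp ->] := cG x y xG yG.
by have [q [? ? _]] := walk_is_path xG xp; exists q.
Qed.

Lemma is_path_first_hit G S x p : is_path G x p -> last x p \in S ->
  exists q, [/\ is_path G x q, last x q \in S, all (fun y => y \notin S) (belast x q)
              & size q <= size p].
Proof.
move=> /and3P[xG xp up] lS.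
suff [q [xq lq aq sub sq]] : exists q, [/\ path (adj G) x q, last x q \in S,
    all (fun y => y \notin S) (belast x q), subseq q p & size q <= size p].
  exists q; split=> //; rewrite /is_path xG xq (subseq_uniq _ up) //=.
  by rewrite eqxx.
elim: p x xp lS {xG up} => [|y p IH] x /=; first by exists [::].
case/andP => xy yp lS; have [xS|xS] := boolP (x \in S).
  by exists [::]; split=> //; rewrite sub0seq.
have [q [yq lq aq sub sq]] := IH y yp lS; exists (y :: q).
by rewrite /= xy yq xS eqxx.
Qed.

Lemma acyclic_sub G H : {subset edges H <= edges G} -> acyclic G -> acyclic H.
Proof.
move=> sub aG c c2 /andP[cc uc]; apply: (aG c c2); apply/andP; split=> //.
by apply: sub_cycle cc => a b; exact: sub.
Qed.

(** A path from [x] to [y] avoiding the edge would close up with it to a cycle. *)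
Lemma acyclic_bridge G x y : is_graph G -> acyclic G -> adj G x y ->
  ~~ connect (adj (del_edge G x y)) x y.
Proof.
move=> gG aG xy; apply/negP => /connectP[p xp].
case/shortenP: xp => q xq uq _ yE.
have [nxy _ _] := adj_verts gG xy.
have sub : {subset edges (del_edge G x y) <= edges G} by move=> e /setD1P[].
apply: (aG (x :: q)); last first.
  rewrite /ucycle uq andbT /= rcons_path -yE adj_sym xy andbT.
  by apply: sub_path xq => a b; exact: sub.
(* The cycle has more than two vertices: an empty [q] would give [x = y], and a single step would be
   the deleted edge. *)
case: q xq yE {uq} => [_ /= E|z [|//]]; first by rewrite E eqxx in nxy.
by move=> /= /andP[zx _] E; move: zx; rewrite -E /adj !inE eqxx.
Qed.

(** If [H] missed the first edge of the path, its ends would stay connected without that edge: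
    through [H] to the end of the path and back along the rest of it. Hence the edge is in [H], and
    induction continues from the next vertex. *)
Lemma acyclic_path_edges G H x p : is_graph G -> acyclic G -> is_path G x p ->
  subgraph H G -> connected H -> x \in verts H -> last x p \in verts H ->
  {subset edges (path_graph x p) <= edges H}.
Proof.
move=> gG aG /and3P[_ xp up] /subgraphP[gH vH eH] /connectedP[_ cH].
elim: p x xp up => [|y p IH] x; first by move=> *; move=> e; rewrite inE.
case/andP => xy yp /andP[xyp up] xH lH.
have xyH : [set x; y] \in edges H.
  apply/negP => /negP nH; have /negP := acyclic_bridge gG aG xy; apply.
  apply: (@connect_trans _ _ (last y p)).
    apply: connect_sub_edges (cH _ _ xH lH); apply/subsetP => e He.
    by rewrite !inE eH // andbT; apply: contra nH => /eqP <-.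
  rewrite connect_adjC.
  have := path_graph_connected y p => /connectedP[_ /(_ y (last y p))].
  rewrite !verts_path_graph mem_head mem_last => /(_ isT isT).
  apply: connect_sub_edges; apply/subsetP => e ep.
  rewrite !inE (path_graph_edges_sub yp) // andbT.
  apply: contra xyp => /eqP E; apply: (edge_path_graph_sub ep).
  by rewrite E !inE eqxx.
have [_ _ yH] := adj_verts gH xyH.
move=> e; rewrite path_graph_cons inE => /orP[/set1P-> //|].
exact: IH.
Qed.

(** Every connected subgraph containing both ends of the path contains all its edges. *)
Lemma acyclic_path_steiner G H x p : is_graph G -> acyclic G -> is_path G x p ->
  subgraph H G -> is_graph H -> connected H -> x \in verts H -> last x p \in verts H ->
  size p <= steiner3 H x (last x p) (last x p).
Proof.
move=> gG aG hp sH gH cH xH lH.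
have sub : [set x; last x p; last x p] \subset verts H by rewrite !subUset !sub1set xH lH.
rewrite /steiner3; have [K [sK cK SK <-]] := steiner_attained gH cH sub.
have /and3P[_ _ up] := hp; rewrite -(size_path_graph up).
apply: subset_leq_card; apply/subsetP; apply: (acyclic_path_edges gG) => //.
- exact: subgraph_trans sH.
- by apply: (subsetP SK); rewrite !inE eqxx.
- by apply: (subsetP SK); rewrite !inE eqxx orbT.
Qed.

(** This shows that the range [k < order_of G] in [dist] covers the lengths of all paths. *)
Lemma is_path_size G x p : is_graph G -> is_path G x p -> size p < order_of G.
Proof.
move=> gG /and3P[xG xp up].
rewrite -[(size p).+1]/(size (x :: p)) /order_of cardE; apply: uniq_leq_size => // z.
by rewrite mem_enum; exact: path_verts.
Qed.

Lemma dist_le G x p : is_graph G -> is_path G x p -> dist G x (last x p) <= size p.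
Proof.
move=> gG hp; have lt := is_path_size gG hp; have /and3P[_ xp _] := hp.
apply: (@bigminn_le_cond _ _ _ _ (Ordinal lt)).
by apply/existsP; exists (in_tuple p); rewrite xp eqxx.
Qed.

Lemma dist_to_le G H x p : is_graph G -> is_path G x p -> last x p \in verts H ->
  dist_to G x H <= size p.
Proof.
move=> gG hp lH; apply: leq_trans (dist_le gG hp).
exact: bigminn_le_cond.
Qed.

Lemma dist_attained G x y : is_graph G -> connected G -> x \in verts G -> y \in verts G ->
  exists p, [/\ path (adj G) x p, last x p = y & size p = dist G x y].
Proof.
move=> gG cG xG yG; have [p hp pE] := connected_is_path cG xG yG.
have /and3P[_ xp _] := hp; have lt := is_path_size gG hp.
have [||k /existsP[q /andP[xq /eqP qE]] kE] := @bigminn_attained _ (order_of G)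
  [pred k : 'I_(order_of G) |
      [exists p : k.-tuple V, path (adj G) x p && (last x p == y)]] (@nat_of_ord _) (Ordinal lt).
- by apply/existsP; exists (in_tuple p); rewrite xp pE eqxx.
- exact: ltnW.
by exists q; split=> //; rewrite size_tuple /dist -kE.
Qed.

Lemma dist_to_attained G H x y : is_graph G -> connected G -> {subset verts H <= verts G} ->
  x \in verts G -> y \in verts H ->
  exists p, [/\ is_path G x p, last x p \in verts H,
    all (fun z => z \notin verts H) (belast x p) & size p <= dist_to G x H].
Proof.
move=> gG cG sub xG yH; have yG := sub y yH.
(* Needed so that the default value of [dist_to] does not win the minimum. *)
have dlt : dist G x y <= order_of G.
  have [p hp <-] := connected_is_path cG xG yG; apply: leq_trans (dist_le gG hp) _.
  exact: ltnW (is_path_size gG hp).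
have [h hH dE] : exists2 h, h \in verts H & dist_to G x H = dist G x h.
  exact: (bigminn_attained yH dlt).
rewrite dE.
have [p [xp pE <-]] := dist_attained gG cG xG (sub h hH).
have [q [hq qE sq]] := walk_is_path xG xp.
have [|q' [? ? ? sq']] := is_path_first_hit (S := verts H) hq; first by rewrite qE pE.
by exists q'; split=> //; exact: leq_trans sq.
Qed.

(** * Branches off a longest path *)

Section LongestPath.
Variables (G : graph V) (u : V) (p0 : seq V).
Hypotheses (gG : is_graph G) (cG : connected G) (hp0 : is_longest_path_from G u p0).
Let P0 := path_graph u p0.

Let hp : is_path G u p0. Proof. by case: hp0. Qed.
Let uG : u \in verts G. Proof. by case/and3P: hp. Qed.
Let subP0 : {subset verts P0 <= verts G}.
Proof. by have /subgraphP[] := path_subgraph gG hp. Qed.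

(** A path to a farthest vertex is a connected subgraph, no larger than [p0] by maximality; in an
    acyclic graph the end of [p0] is at distance exactly [size p0]. *)
Lemma ecc2_longest : acyclic G -> ecc 2 u G = size p0.
Proof.
move=> aG; apply/eqP; rewrite eqn_leq; apply/andP; split.
  have [x xG ->] := ecc2_attained gG uG.
  have [p pp pE] := connected_is_path cG uG xG; have /and3P[_ _ up] := pp.
  have sz : size_of (path_graph u p) <= size p0.
    by rewrite size_path_graph //; case: hp0 => _; apply.
  apply: leq_trans sz.
  apply: steiner_le; [exact: path_subgraph|exact: path_graph_connected|].
  by rewrite !subUset !sub1set !verts_path_graph mem_head -pE mem_last.
have lG : last u p0 \in verts G by apply: subP0; rewrite verts_path_graph mem_last.
apply: leq_trans (steiner3_le_ecc2 gG cG uG lG).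
exact: (acyclic_path_steiner gG aG hp (subgraph_refl gG)).
Qed.

(* Leaving [P0] towards [y] at its later exit point gives a path from [u], of
   length at most [size p0]; it already meets the branch leading to [x]. *)
Lemma steiner3_longest_le x y : x \in verts G -> y \in verts G ->
  steiner3 G u x y <= size p0 + ecc_sub G P0.
Proof.
move=> xG yG.
have u0 : u \in verts P0 by rewrite verts_path_graph mem_head.
have [qx [hx lx ax sx]] := dist_to_attained gG cG subP0 xG u0.
have [qy [hy ly ay sy]] := dist_to_attained gG cG subP0 yG u0.
have ex t : t \in verts G -> dist_to G t P0 <= ecc_sub G P0.
  by move=> tG; rewrite /ecc_sub (bigD1 t) // leq_maxl.
have {}sx := leq_trans sx (ex x xG); have {}sy := leq_trans sy (ex y yG).
(* [last x qx] and [last y qy] are the points where the branches of [x] and [y] leave [P0]; [y] is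
   taken to leave it later. *)
wlog le : x y qx qy xG yG hx hy lx ly ax ay sx sy /
    index (last x qx) (u :: p0) <= index (last y qy) (u :: p0).
  move=> W; case: (leqP (index (last x qx) (u :: p0)) (index (last y qy) (u :: p0))) => le.
    exact: (W x y qx qy).
  by rewrite steiner3C23; apply: (W y x qy qx) => //; exact: ltnW.
have /and3P[_ up0 uu] := hp.
rewrite !verts_path_graph in lx ly.
set k := index (last y qy) (u :: p0) in le.
have kle : k <= size p0 by rewrite -ltnS -[(size p0).+1]/(size (u :: p0)) index_mem.
set p1 := take k p0.
have p1E : u :: p1 = take k.+1 (u :: p0) by [].
have last_p1 : last u p1 = last y qy.
  rewrite -[RHS](nth_index u ly) -/k (last_nth u) p1E size_take_min (minn_idPl kle).
  by rewrite nth_take.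
(* The branch of [x] leaves [P0] no later than [p1] ends, so [qx] can be attached to [p1]. *)
have x1 : last x qx \in u :: p1.
  by rewrite p1E -(nth_index u lx) -(nth_take u (n0 := k.+1)) // mem_nth // size_take_min leq_min /=
    !ltnS le (leq_trans le kle).
have path1 : path (adj G) u p1 by move: up0; rewrite -{1}(cat_take_drop k p0) cat_path => /andP[].
have uniq1 : uniq (u :: p1) by rewrite p1E take_uniq.
have sub1 : {subset u :: p1 <= u :: p0} by rewrite p1E => t /mem_take.
have h1 : is_path G u p1 by rewrite /is_path uG path1.
have /and3P[_ yqy uqy] := hy; have /and3P[_ xqx uqx] := hx.
(* Following [p1] and then [qy] backwards is a path from [u] to [y], as [qy] meets [P0] only at its
   end; the maximality of [p0] applies. *)
have sz : size p1 + size qy <= size p0.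
  rewrite -(size_belast y qy) -(size_rev (belast y qy)) -size_cat.
  case: hp0 => _; apply; apply/and3P; split=> //.
    rewrite cat_path path1 last_p1 rev_path.
    by apply: sub_path yqy => a b; rewrite adj_sym.
  rewrite -cat_cons cat_uniq uniq1 rev_uniq; apply/and3P; split=> //; last first.
    by move: uqy; rewrite lastI rcons_uniq => /andP[].
  apply/hasPn => t; rewrite mem_rev => /(allP ay); rewrite verts_path_graph.
  by apply: contra => /sub1.
set H := gunion (gunion (path_graph u p1) (path_graph y qy)) (path_graph x qx).
have sH : size_of H <= size p0 + ecc_sub G P0.
  apply: leq_trans (size_gunion _ _) _; apply: leq_add; last by rewrite size_path_graph.
  by apply: leq_trans (size_gunion _ _) _; rewrite !size_path_graph.
apply: leq_trans sH; apply: steiner_le.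
- by apply: subgraph_gunion; [apply: subgraph_gunion|]; exact: path_subgraph.
- apply: (@connected_gunion _ _ _ (last x qx)); rewrite ?verts_path_graph ?mem_last //.
  + by rewrite inE verts_path_graph x1.
  + apply: (@connected_gunion _ _ _ (last y qy)); rewrite ?verts_path_graph ?mem_last //.
    * by rewrite -last_p1 mem_last.
    * exact: path_graph_connected.
    * exact: path_graph_connected.
  + exact: path_graph_connected.
- by rewrite !subUset !sub1set !in_setU !verts_path_graph !mem_head !orbT.
Qed.

(** Witnesses are the end of [P0] and a vertex [z] farthest from [P0]. A connected subgraph
    containing them and [u] contains all of [P0], and in addition a path from [z] to [P0] sharing no
    edge with it. *)
Lemma steiner3_longest_attained : acyclic G ->
  exists x y, [/\ x \in verts G, y \in verts G
    & size p0 + ecc_sub G P0 <= steiner3 G u x y].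
Proof.
move=> aG; have lG : last u p0 \in verts G by apply: subP0; rewrite verts_path_graph mem_last.
have [|z zG zE] := @eq_bigmax_cond _ (mem (verts G)) (fun z => dist_to G z P0).
  by apply/card_gt0P; exists u.
exists (last u p0), z; split=> //.
have sub : [set u; last u p0; z] \subset verts G by rewrite !subUset !sub1set uG lG zG.
rewrite /steiner3; have [K [sK cK SK <-]] := steiner_attained gG cG sub.
have uK : u \in verts K by apply: (subsetP SK); rewrite !inE eqxx.
have lK : last u p0 \in verts K by apply: (subsetP SK); rewrite !inE eqxx orbT.
have zK : z \in verts K by apply: (subsetP SK); rewrite !inE eqxx orbT.
have [gK vK eK] := subgraphP _ _ sK.
have [q1 hq1 q1u] := connected_is_path cK zK uK.
have [|q [hq lq aq _]] := is_path_first_hit (S := verts P0) hq1.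
  by rewrite q1u verts_path_graph mem_head.
have hqG : is_path G z q.
  case/and3P: hq => _ zq uq; rewrite /is_path zG uq andbT.
  by apply: sub_path zq => a b; exact: eK.
have /and3P[_ zq uq] := hq; have /and3P[_ _ up] := hp.
have := dist_to_le gG hqG lq; rewrite /ecc_sub zE => le.
apply: leq_trans (_ : size p0 + size q <= _); first by rewrite leq_add2l.
rewrite -(size_path_graph up) -(size_path_graph uq) /size_of -cardsUI.
have -> : edges (path_graph u p0) :&: edges (path_graph z q) = set0.
  apply/setP => e; rewrite in_set0 in_setI; apply/negP => /andP[e0 eq].
  have sub0 := edge_path_graph_sub e0.
  (* Each edge of [q] begins at a vertex before the first hit of [P0], thus off [P0]. *)
  suff [t te tP] : exists2 t, t \in e & t \notin verts P0.
    by move: tP; rewrite verts_path_graph => /negP; apply; exact: sub0.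
  elim: q z eq aq {hq hqG lq zq uq sub K sK cK SK uK lK zK gK vK eK q1 hq1 q1u zG zE le}
    => [|y q IH] z; first by rewrite inE.
  rewrite path_graph_cons inE /= => /orP[/set1P-> /andP[zP _]|eq /andP[_]].
    by exists z; rewrite // !inE eqxx.
  exact: IH.
rewrite cards0 addn0; apply: subset_leq_card; rewrite subUset; apply/andP; split.
  by apply/subsetP; exact: (acyclic_path_edges gG aG hp sK cK).
by apply/subsetP; exact: path_graph_edges_sub.
Qed.

End LongestPath.
End Paths.

(** * Comparison of eccentricities *)

Section RootedSteiner.
Variables (V : finType) (G : graph V) (r : V).
Hypotheses (gG : is_graph G) (cG : connected G) (rG : r \in verts G).
Implicit Types x y z : V.

Let sub3 x y z : x \in verts G -> y \in verts G -> z \in verts G ->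
  [set x; y; z] \subset verts G.
Proof. by move=> xG yG zG; rewrite !subUset !sub1set xG yG zG. Qed.

Lemma steiner3_root_self : steiner3 G r r r = 0.
Proof. by rewrite /steiner3 !setUid steiner_set1. Qed.

Lemma steiner3_root_mono x y : x \in verts G -> y \in verts G ->
  steiner3 G r x x <= steiner3 G r x y.
Proof.
move=> xG yG; apply: steiner_mono; rewrite ?sub3 //.
by apply/subsetP => z; rewrite !inE => /orP[/orP[]|] ->; rewrite ?orbT.
Qed.

(** Two subgraphs through [r], one for [x] and [y] and one for [z], are joined at [r]. *)
Lemma steiner3_le_root x y z : x \in verts G -> y \in verts G -> z \in verts G ->
  steiner3 G x y z <= steiner3 G r x y + steiner3 G r z z.
Proof.
move=> xG yG zG; apply: leq_trans (steinerU gG cG (x := r) (sub3 rG xG yG) (sub3 rG zG zG) _ _).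
- apply: steiner_mono => //; first by rewrite subUset !sub3.
  by apply/subsetP => t; rewrite !inE => /orP[/orP[]|] ->; rewrite ?orbT.
- by rewrite !inE eqxx.
- by rewrite !inE eqxx.
Qed.

Lemma steiner3_root_subadd x y : x \in verts G -> y \in verts G ->
  steiner3 G r x y <= steiner3 G r x x + steiner3 G r y y.
Proof.
move=> xG yG; apply: leq_trans (steiner3_le_root rG xG yG) _.
by rewrite leq_add2r /steiner3 setUid -setUA setUid.
Qed.

End RootedSteiner.

(* [t] and [t'] are the Steiner distances of triples in [T] and [T'], and
   [f0], [f1], [fP] those of [T0], [T1], [P] with the root as a third vertex;
   [V1] excludes [w].  Moving [T1] across [uw] only affects whether a triple
   pays for the edge [uw]. *)
(* Membership hypotheses are boolean atoms that make [lia] very slow. *)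
Ltac nat_lia := intros;
  repeat match goal with
  | H : is_true (@in_mem _ _ _) |- _ => clear H
  | H : forall _, _ |- _ => clear H
  | H : exists _, _ |- _ => clear H
  | H : exists2 _, _ & _ |- _ => clear H
  end; lia.

Section Comparison.
Variables (V : finType) (VT V0 V1 VP : {set V}) (t t' : V -> V -> V -> nat).
Variables (f0 f1 fP : V -> V -> nat) (E E' : V -> nat) (a b c e0 : nat).
Implicit Types x y z v : V.

Hypothesis loc : forall v, v \in VT -> [\/ v \in V0, v \in V1 | v \in VP].
Hypotheses (sub0 : {subset V0 <= VT}) (sub1 : {subset V1 <= VT}) (subP : {subset VP <= VT}).
Hypotheses (dis10 : forall v, v \in V1 -> v \notin V0) (disP0 : forall v, v \in VP -> v \notin V0).
Hypotheses (t12 : forall x y z, t x y z = t y x z) (t23 : forall x y z, t x y z = t x z y).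
Hypotheses (t12' : forall x y z, t' x y z = t' y x z) (t23' : forall x y z, t' x y z = t' x z y).

(** The names list the pieces met by the triple. In [t] the edge [uw] is paid for when the triple
    meets both [V0] and the rest; in [t'], when it meets both [VP] and the rest. *)
Hypothesis e000 : forall x y z, x \in V0 -> y \in V0 -> z \in V0 -> t' x y z = t x y z.
Hypothesis e111 : forall x y z, x \in V1 -> y \in V1 -> z \in V1 -> t' x y z = t x y z.
Hypothesis ePPP : forall x y z, x \in VP -> y \in VP -> z \in VP -> t' x y z = t x y z.
Hypothesis e001 : forall x y z, x \in V0 -> y \in V0 -> z \in V1 ->
  t x y z = f0 x y + f1 z z + 1 /\ t' x y z = f0 x y + f1 z z.
Hypothesis e00P : forall x y z, x \in V0 -> y \in V0 -> z \in VP ->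
  t x y z = f0 x y + fP z z + 1 /\ t' x y z = f0 x y + fP z z + 1.
Hypothesis e011 : forall x y z, x \in V0 -> y \in V1 -> z \in V1 ->
  t x y z = f0 x x + f1 y z + 1 /\ t' x y z = f0 x x + f1 y z.
Hypothesis e01P : forall x y z, x \in V0 -> y \in V1 -> z \in VP ->
  t x y z = f0 x x + f1 y y + fP z z + 1 /\ t' x y z = f0 x x + f1 y y + fP z z + 1.
Hypothesis e0PP : forall x y z, x \in V0 -> y \in VP -> z \in VP ->
  t x y z = f0 x x + fP y z + 1 /\ t' x y z = f0 x x + fP y z + 1.
Hypothesis e11P : forall x y z, x \in V1 -> y \in V1 -> z \in VP ->
  t x y z = f1 x y + fP z z /\ t' x y z = f1 x y + fP z z + 1.
Hypothesis e1PP : forall x y z, x \in V1 -> y \in VP -> z \in VP ->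
  t x y z = f1 x x + fP y z /\ t' x y z = f1 x x + fP y z + 1.

Hypothesis t_le : forall v x y, v \in VT -> x \in VT -> y \in VT -> t v x y <= E v.
Hypothesis t_le' : forall v x y, v \in VT -> x \in VT -> y \in VT -> t' v x y <= E' v.
Hypothesis t_att : forall v, v \in VT -> exists x y, [/\ x \in VT, y \in VT & E v = t v x y].
Hypothesis t_att' : forall v, v \in VT -> exists x y, [/\ x \in VT, y \in VT & E' v = t' v x y].

Hypothesis f0_le : forall x, x \in V0 -> f0 x x <= a.
Hypothesis f1_le : forall x, x \in V1 -> f1 x x <= c.
Hypothesis fP_le : forall x y, x \in VP -> y \in VP -> fP x y <= b.
Hypothesis f0_att : exists2 x, x \in V0 & f0 x x = a.
(** The premise says that [V1] is nonempty; it is empty when [T1] is reduced to [w]. *)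
Hypothesis f1_att : forall y, y \in V1 -> exists2 x, x \in V1 & f1 x x = c.
Hypothesis fP_att : exists2 x, x \in VP & fP x x = b.
Hypothesis f0_le2 : forall x y, x \in V0 -> y \in V0 -> f0 x y <= a + e0.
Hypothesis f0_att2 : exists x y, [/\ x \in V0, y \in V0 & a + e0 <= f0 x y].
Hypothesis f0_mono : forall x y, x \in V0 -> y \in V0 -> f0 x x <= f0 x y.
Hypothesis f0_subadd : forall x y, x \in V0 -> y \in V0 -> f0 x y <= f0 x x + f0 y y.
Hypothesis f1_subadd : forall x y, x \in V1 -> y \in V1 -> f1 x y <= f1 x x + f1 y y.
Hypothesis t0_le : forall x y z, x \in V0 -> y \in V0 -> z \in V0 -> t x y z <= f0 x x + f0 y z.
Hypothesis t1_le : forall x y z, x \in V1 -> y \in V1 -> z \in V1 -> t x y z <= f1 x y + f1 z z.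
Hypothesis lt_ba : b < a.

Lemma pair_cases (Q : V -> V -> Prop) : (forall x y, Q x y -> Q y x) ->
  (forall x y, x \in V0 -> y \in V0 -> Q x y) -> (forall x y, x \in V0 -> y \in V1 -> Q x y) ->
  (forall x y, x \in V0 -> y \in VP -> Q x y) -> (forall x y, x \in V1 -> y \in V1 -> Q x y) ->
  (forall x y, x \in V1 -> y \in VP -> Q x y) -> (forall x y, x \in VP -> y \in VP -> Q x y) ->
  forall x y, x \in VT -> y \in VT -> Q x y.
Proof. by move=> sym ? ? ? ? ? ? x y /loc[] ? /loc[] ?; auto. Qed.

(** By symmetry in the last two arguments, six placements of the other two vertices suffice. *)
Lemma ecc_bound v (m : nat) : v \in VT ->
  (forall x y, x \in V0 -> y \in V0 -> t v x y <= m) ->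
  (forall x y, x \in V0 -> y \in V1 -> t v x y <= m) ->
  (forall x y, x \in V0 -> y \in VP -> t v x y <= m) ->
  (forall x y, x \in V1 -> y \in V1 -> t v x y <= m) ->
  (forall x y, x \in V1 -> y \in VP -> t v x y <= m) ->
  (forall x y, x \in VP -> y \in VP -> t v x y <= m) ->
  E v <= m.
Proof.
move=> vT *; have [x [y [xT yT ->]]] := t_att vT; move: x y xT yT.
by apply: pair_cases => // x y; rewrite t23.
Qed.

Lemma ecc_bound' v (m : nat) : v \in VT ->
  (forall x y, x \in V0 -> y \in V0 -> t' v x y <= m) ->
  (forall x y, x \in V0 -> y \in V1 -> t' v x y <= m) ->
  (forall x y, x \in V0 -> y \in VP -> t' v x y <= m) ->
  (forall x y, x \in V1 -> y \in V1 -> t' v x y <= m) ->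
  (forall x y, x \in V1 -> y \in VP -> t' v x y <= m) ->
  (forall x y, x \in VP -> y \in VP -> t' v x y <= m) ->
  E' v <= m.
Proof.
move=> vT *; have [x [y [xT yT ->]]] := t_att' vT; move: x y xT yT.
by apply: pair_cases => // x y; rewrite t23'.
Qed.

Let t231 x y z : t x y z = t y z x. Proof. by rewrite t12 t23. Qed.
Let t312 x y z : t x y z = t z x y. Proof. by rewrite t23 t12. Qed.
Let t231' x y z : t' x y z = t' y z x. Proof. by rewrite t12' t23'. Qed.

(** A triple meeting [V0] that pays in [t'] also meets [VP], hence pays in [t] too. *)
Lemma ecc_V0 v : v \in V0 -> E' v <= E v.
Proof.
move=> v0; have vT := sub0 v0; apply: ecc_bound' => // x y hx hy;
  (have xT : x \in VT by auto); (have yT : y \in VT by auto); have := t_le vT xT yT.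
- by rewrite e000.
- have [-> ->] := e001 v0 hx hy; nat_lia.
- have [-> ->] := e00P v0 hx hy; nat_lia.
- have [-> ->] := e011 v0 hx hy; nat_lia.
- have [-> ->] := e01P v0 hx hy; nat_lia.
- have [-> ->] := e0PP v0 hx hy; nat_lia.
Qed.
(** Only triples inside [V1] and [VP] meeting both become dearer. Exchanging their vertices of [VP]
    for a farthest vertex [x0] of [V0] gives a triple that pays in [t], and [b < a] makes up the
    rest. *)
Lemma ecc_V1 v : v \in V1 -> E' v <= E v.
Proof.
move=> v1; have vT := sub1 v1; have [x0 h0 x0E] := f0_att.
apply: ecc_bound' => // x y hx hy;
  (have xT : x \in VT by auto); (have yT : y \in VT by auto); have := t_le vT xT yT.
- rewrite t231 t231'; have [-> ->] := e001 hx hy v1; nat_lia.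
- rewrite t12 t12'; have [-> ->] := e011 hx v1 hy; nat_lia.
- rewrite t12 t12'; have [-> ->] := e01P hx v1 hy; nat_lia.
- by rewrite e111.
- have := t_le vT xT (sub0 h0); rewrite t312; have [-> _] := e011 h0 v1 hx.
  have [_ ->] := e11P v1 hx hy; have := fP_le hy hy; nat_lia.
- have := t_le vT vT (sub0 h0); rewrite t312; have [-> _] := e011 h0 v1 v1.
  have [_ ->] := e1PP v1 hx hy; have := fP_le hx hy; nat_lia.
Qed.

(** A dearer triple with only one vertex in [V1] is dominated by replacing its second vertex of [VP]
    by [x0]. Two vertices in [V1] are the only remaining danger, isolated in the last premise. *)
Lemma ecc_VP_gen v (m : nat) : v \in VP -> E v <= m ->
  (forall x y, x \in V1 -> y \in V1 -> f1 x y + fP v v + 1 <= m) -> E' v <= m.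
Proof.
move=> vP Em h11; have vT := subP vP; have [x0 h0 x0E] := f0_att.
apply: ecc_bound' => // x y hx hy;
  (have xT : x \in VT by auto); (have yT : y \in VT by auto);
  have tE := leq_trans (t_le vT xT yT) Em.
- by move: tE; rewrite t231 t231'; have [-> ->] := e00P hx hy vP; nat_lia.
- by move: tE; rewrite t231 t231'; have [-> ->] := e01P hx hy vP; nat_lia.
- by move: tE; rewrite t12 t12'; have [-> ->] := e0PP hx vP hy; nat_lia.
- by rewrite t231'; have [_ ->] := e11P hx hy vP; exact: h11.
- rewrite t12'; have [_ ->] := e1PP hx vP hy.
  have := leq_trans (t_le vT (sub0 h0) xT) Em; rewrite t231; have [-> _] := e01P h0 hx vP.
  have := fP_le vP hy; nat_lia.
- by rewrite ePPP.
Qed.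

Lemma ecc_VP_succ v : v \in VP -> E' v <= E v + 1.
Proof.
move=> vP; apply: ecc_VP_gen => //; first exact: leq_addr.
move=> x y hx hy; have := t_le (subP vP) (sub1 hx) (sub1 hy); rewrite t231.
have [-> _] := e11P hx hy vP; nat_lia.
Qed.

(** Farthest vertices of [V0] and [V1] together with [v] already cost [a + c + fP v v + 1] in [t],
    which covers the case left open by [ecc_VP_gen]. *)
Lemma ecc_VP v : (forall x y, x \in V1 -> y \in V1 -> f1 x y <= a + c) ->
  v \in VP -> E' v <= E v.
Proof.
move=> h vP; apply: ecc_VP_gen => // x y hx hy.
have [x0 h0 x0E] := f0_att; have [y0 h1 y0E] := f1_att hx.
have := t_le (subP vP) (sub0 h0) (sub1 h1); rewrite t231; have [-> _] := e01P h0 h1 vP.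
have := h x y hx hy; nat_lia.
Qed.

Lemma ecc_V0_lt v y1 y2 : y1 \in V1 -> y2 \in V1 -> a + c < f1 y1 y2 ->
  v \in V0 -> E' v < E v.
Proof.
move=> h1 h2 big v0; have vT := sub0 v0.
have := t_le vT (sub1 h1) (sub1 h2); have [-> _] := e011 v0 h1 h2 => Ebig.
(* Subadditivity bounds [f1 y1 y2] by [c + c], so [a < c]. Hence triples that do not lose the edge
   stay below the value reached in [t] by [v], [y1], [y2]. *)
have := f1_subadd h1 h2; have := f1_le h1; have := f1_le h2 => c2 c1 cc.
suff: E' v <= E v - 1 by nat_lia.
apply: ecc_bound' => // x y hx hy;
  (have xT : x \in VT by auto); (have yT : y \in VT by auto); have := t_le vT xT yT.
- rewrite e000 //; have := t0_le v0 hx hy; have := f0_subadd hx hy.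
  have := f0_le hx; have := f0_le hy; nat_lia.
- have [-> ->] := e001 v0 hx hy; nat_lia.
- have [_ ->] := e00P v0 hx hy; have := fP_le hy hy; have := f0_subadd v0 hx.
  have := f0_le hx; nat_lia.
- have [-> ->] := e011 v0 hx hy; nat_lia.
- have [_ ->] := e01P v0 hx hy; have := fP_le hy hy; have := f1_le hx; nat_lia.
- have [_ ->] := e0PP v0 hx hy; have := fP_le hx hy; nat_lia.
Qed.

(** Upward, [f1 x y <= c + c < a + c] excludes a gain on [VP]. Downward, in a triple losing the
    edge, one vertex of [V1] other than [v] is replaced by the far end [z0] of [P], at no loss since
    [c <= b]; for [v] in [V1] and a pair in [V0], the pair is replaced by [x0], [z0], using
    [e0 <= b]. *)
Lemma ecc_eq : e0 <= b -> c <= b -> forall v, v \in VT -> E' v = E v.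
Proof.
move=> eb cb v vT; have [z0 hz z0E] := fP_att; have [x0 h0 x0E] := f0_att.
have zT := subP hz.
apply/eqP; rewrite eqn_leq; apply/andP; split.
  case: (loc vT) => hv; [exact: ecc_V0|exact: ecc_V1|apply: ecc_VP => // x y hx hy].
  have := f1_subadd hx hy; have := f1_le hx; have := f1_le hy; nat_lia.
case: (loc vT) => hv; apply: ecc_bound => // x y hx hy;
  (have xT : x \in VT by auto); (have yT : y \in VT by auto); have := t_le' vT xT yT.
- by rewrite e000.
- have [-> _] := e001 hv hx hy; have := t_le' vT xT zT; have [_ ->] := e00P hv hx hz.
  have := f1_le hy; nat_lia.
- have [-> ->] := e00P hv hx hy; nat_lia.
- have [-> _] := e011 hv hx hy; have := t_le' vT xT zT; have [_ ->] := e01P hv hx hz.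
  have := f1_subadd hx hy; have := f1_le hy; nat_lia.
- have [-> ->] := e01P hv hx hy; nat_lia.
- have [-> ->] := e0PP hv hx hy; nat_lia.
- rewrite t231; have [-> _] := e001 hx hy hv; have := t_le' vT (sub0 h0) zT.
  rewrite t12'; have [_ ->] := e01P h0 hv hz; have := f0_le2 hx hy; nat_lia.
- rewrite t12; have [-> _] := e011 hx hv hy; have := t_le' vT xT zT.
  rewrite t12'; have [_ ->] := e01P hx hv hz; have := f1_subadd hv hy; have := f1_le hy; nat_lia.
- rewrite t12 t12'; have [-> ->] := e01P hx hv hy; nat_lia.
- by rewrite e111.
- have [-> ->] := e11P hv hx hy; nat_lia.
- have [-> ->] := e1PP hv hx hy; nat_lia.
- rewrite t231 t231'; have [-> ->] := e00P hx hy hv; nat_lia.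
- rewrite t231 t231'; have [-> ->] := e01P hx hy hv; nat_lia.
- rewrite t12 t12'; have [-> ->] := e0PP hx hv hy; nat_lia.
- rewrite t231 t231'; have [-> ->] := e11P hx hy hv; nat_lia.
- rewrite t12 t12'; have [-> ->] := e1PP hx hv hy; nat_lia.
- by rewrite ePPP.
Qed.

(** In [t], [u] with farthest vertices of [V0] and [V1] reaches [a + c + 1]. Triples in [t'] that do
    not lose the edge reach at most [a + c]: pairs in [V0] by [e0 <= c], the others by [b < c] and
    [b < a]. *)
Lemma ecc_root_lt u y : u \in V0 -> f0 u u = 0 -> (forall x z, x \in V0 -> z \in V0 -> t u x z = f0 x z) ->
  y \in V1 -> b < c -> e0 <= c -> E' u < E u.
Proof.
move=> hu fu tu hy0 bc ec; have uT := sub0 hu.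
have [x0 h0 x0E] := f0_att; have [y0 h1 y0E] := f1_att hy0.
have := t_le uT (sub0 h0) (sub1 h1); rewrite t12; have [-> _] := e001 h0 hu h1 => Ebig.
have := f0_mono h0 hu => m0.
suff: E' u <= E u - 1 by nat_lia.
apply: ecc_bound' => // x z hx hz;
  (have xT : x \in VT by auto); (have zT : z \in VT by auto); have := t_le uT xT zT.
- rewrite e000 // tu //; have := f0_le2 hx hz; nat_lia.
- have [-> ->] := e001 hu hx hz; nat_lia.
- have [_ ->] := e00P hu hx hz; have := fP_le hz hz; have := f0_subadd hu hx; have := f0_le hx; nat_lia.
- have [-> ->] := e011 hu hx hz; nat_lia.
- have [_ ->] := e01P hu hx hz; have := f1_le hx; have := fP_le hz hz; nat_lia.
- have [_ ->] := e0PP hu hx hz; have := fP_le hx hz; nat_lia.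
Qed.

(** In [t], [v] with a best pair of [V0] reaches [a + e0 + f1 v v + 1], and that triple loses the
    edge. Since [e0 <= a], both [b] and [c] are below [a], so a triple with its other vertices in
    [V1] or [VP] is beaten by one using [x0]. *)
Lemma ecc_branch_lt v : v \in V1 -> b < e0 -> c < e0 -> E' v < E v.
Proof.
move=> hv be ce; have vT := sub1 hv.
have [x0 h0 x0E] := f0_att; have [x1 [x2 [h1 h2 big]]] := f0_att2.
have := t_le vT (sub0 h1) (sub0 h2); rewrite t231; have [-> _] := e001 h1 h2 hv => Ebig.
have e0a : e0 <= a by have := f0_subadd h1 h2; have := f0_le h1; have := f0_le h2; nat_lia.
suff: E' v <= E v - 1 by nat_lia.
apply: ecc_bound' => // x y hx hy;
  (have xT : x \in VT by auto); (have yT : y \in VT by auto); have := t_le vT xT yT.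
- rewrite t231 t231'; have [-> ->] := e001 hx hy hv; nat_lia.
- rewrite t12 t12'; have [-> ->] := e011 hx hv hy; nat_lia.
- rewrite t12 t12'; have [-> ->] := e01P hx hv hy; have := f0_le hx; have := fP_le hy hy; nat_lia.
- rewrite e111 //; have := t_le vT xT (sub0 h0); rewrite t312; have [-> _] := e011 h0 hv hx.
  have := t1_le hv hx hy; have := f1_le hy; nat_lia.
- have := t_le vT xT (sub0 h0); rewrite t312; have [-> _] := e011 h0 hv hx.
  have [_ ->] := e11P hv hx hy; have := fP_le hy hy; nat_lia.
- have [_ ->] := e1PP hv hx hy; have := fP_le hx hy; nat_lia.
Qed.

Lemma sum_ecc_lt u : u \in V0 -> f0 u u = 0 -> (forall x z, x \in V0 -> z \in V0 -> t u x z = f0 x z) ->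
  V1 != set0 -> #|VP| < #|V0| -> ~~ ((e0 <= b) && (c <= b)) ->
  \sum_(v in VT) E' v < \sum_(v in VT) E v.
Proof.
move=> hu fu tu /set0Pn[y hy] card ncond.
have [/existsP[y1 /existsP[y2 /and3P[h1 h2 big]]]|small] :=
  boolP [exists y1, exists y2, [&& y1 \in V1, y2 \in V1 & a + c < f1 y1 y2]].
  have cardS (S : {set V}) : {subset S <= VT} -> \sum_(v in VT) (v \in S) = #|S|.
    move=> sub; rewrite -sum1_card (big_setID S) /= (setIidPr _); last exact/subsetP.
    rewrite [X in _ + X]big1 ?addn0; last by move=> v /setDP[_ /negbTE ->].
    by apply: eq_bigr => v ->.
  (* Each vertex of [V0] loses at least 1 and each vertex of [VP] gains at most 1; indicator sums
     turn [#|VP| < #|V0|] into strictness. *)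
  have : \sum_(v in VT) (E' v + (v \in V0)) <= \sum_(v in VT) (E v + (v \in VP)).
    apply: leq_sum => v vT; case: (loc vT) => hv.
    - have := ecc_V0_lt h1 h2 big hv; rewrite hv; nat_lia.
    - have := ecc_V1 hv; rewrite (negbTE (dis10 hv)); nat_lia.
    - have := ecc_VP_succ hv; rewrite hv (negbTE (disP0 hv)); nat_lia.
  by rewrite !big_split /= !cardS //; nat_lia.
have h11 x z : x \in V1 -> z \in V1 -> f1 x z <= a + c.
  move=> hx hz; rewrite leqNgt; apply: contra small => big.
  by apply/existsP; exists x; apply/existsP; exists z; rewrite hx hz.
have le v : v \in VT -> E' v <= E v.
  by case/loc => hv; [exact: ecc_V0|exact: ecc_V1|exact: ecc_VP].
have [v vT lt] : exists2 v, v \in VT & E' v < E v.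
  (* If this alternative fails, [ncond] forces both [b < e0] and [c < e0], and [y] is the vertex
     that loses. *)
  have [/andP[bc ec]|ncA] := boolP ((b < c) && (e0 <= c)).
    by exists u; [exact: sub0|exact: (ecc_root_lt (y := y))].
  by exists y; [exact: sub1|apply: ecc_branch_lt => //; lia].
rewrite (bigD1 v) //= [ltnRHS](bigD1 v) //= -addSn leq_add //.
by apply: leq_sum => z /andP[/le].
Qed.

Lemma ecc_comparison u : u \in V0 -> f0 u u = 0 ->
  (forall x z, x \in V0 -> z \in V0 -> t u x z = f0 x z) -> #|VP| < #|V0| ->
  (e0 <= b -> c <= b -> forall v, v \in VT -> E' v = E v) /\
  (V1 != set0 -> ~~ ((e0 <= b) && (c <= b)) -> \sum_(v in VT) E' v < \sum_(v in VT) E v).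
Proof. by move=> *; split=> [|*]; [exact: ecc_eq|apply: (@sum_ecc_lt u)]. Qed.

End Comparison.

(** * The edge switch *)

Section Structure.
Variable V : finType.
Implicit Types (G X Y Z : graph V) (e : {set V}) (x y z u w r s : V).

Lemma component_is_graph G x : is_graph G -> is_graph (component G x).
Proof.
move=> gG; apply: is_graphP => e; rewrite inE => /andP[eG /subsetP sub].
have [y [z [E yz yG zG]]] := graph_edgeE gG eG.
by exists y, z; split=> //; apply: sub; rewrite E !inE eqxx ?orbT.
Qed.

Lemma component_connected G x : connected (component G x).
Proof.
apply: (@connected_from _ _ x) => [|y]; rewrite inE ?connect0 // => /connectP[q].
elim/last_ind: q y => [|q z IH] y; first by move=> _ ->.
rewrite rcons_path last_rcons => /andP[xq qz] ->.
apply: connect_trans (IH _ xq erefl) (connect1 _).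
have xl : connect (adj G) x (last x q) by apply/connectP; exists q.
rewrite /adj inE [_ \in edges G]qz subUset !sub1set !inE xl.
exact: connect_trans (connect1 qz).
Qed.

Lemma is_graph_del_edge G x y : is_graph G -> is_graph (del_edge G x y).
Proof. by move=> gG; apply: is_graphP => e /setD1P[_ /(graph_edgeE gG)]. Qed.

(** Along a walk of [G] from [u], being reachable in [D] from [u] or from [w] is preserved: the
    deleted edge only leads to one of these two vertices. *)
Lemma edge_split G u w : is_graph G -> connected G -> adj G u w ->
  let D := del_edge G u w in
  G = gunion (gunion (component D u) (edge_graph u w)) (component D w).
Proof.
move=> gG /connectedP[_ cG] uw D; have [nuw uG wG] := adj_verts gG uw.
have gD := is_graph_del_edge u w gG.
have sides x y : adj G x y ->
    (connect (adj D) u x || connect (adj D) w x) -> connect (adj D) u y || connect (adj D) w y.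
  have [xyE _|xyD xy] := eqVneq [set x; y] [set u; w].
    have : y \in [set u; w] by rewrite -xyE !inE eqxx orbT.
    by rewrite !inE => /orP[] /eqP ->; rewrite connect0 ?orbT.
  have {}xy : adj D x y by rewrite /adj !inE xyD.
  by case/orP => /connect_trans /(_ (connect1 xy)) ->; rewrite ?orbT.
have cover x : x \in verts G -> connect (adj D) u x || connect (adj D) w x.
  move=> xG; have /connectP[q] := cG u x uG xG.
  elim/last_ind: q x {xG} => [|q y IH] x; first by move=> _ ->; rewrite connect0.
  by rewrite rcons_path last_rcons => /andP[/IH /(_ erefl) lq /sides] /(_ lq) + ->.
have inG x y : x \in verts G -> connect (adj D) x y -> y \in verts G.
  move=> xG /connectP[q xq ->]; apply: (path_verts gD xG xq); exact: mem_last.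
apply: injective_projections; apply/setP => x; rewrite !inE.
  apply/idP/idP => [/cover/orP[] ->|]; rewrite ?orbT //.
  by case/orP => [/orP[/(inG _ _ uG)|/orP[]/eqP->]|/(inG _ _ wG)].
have [->|xuw] := eqVneq x [set u; w]; first by rewrite orbT.
rewrite orbF /=; apply/idP/idP => [xE|/orP[]/andP[] //].
have xD : x \in edges D by rewrite !inE xuw.
rewrite xE /=; have [y [z [E yz yG zG]]] := graph_edgeE gD xD.
have yz' : connect (adj D) y z by apply: connect1; rewrite /adj -E.
rewrite E !subUset !sub1set !inE.
by case/orP: (cover y yG) => yc; rewrite yc (connect_trans yc yz') ?orbT.
Qed.

Lemma relabel_tperm_vert r s Y x :
  (x \in verts (relabel (tperm r s) Y)) = (tperm r s x \in verts Y).
Proof. by rewrite -{1}(tpermK r s x) mem_imset //; exact: perm_inj. Qed.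

(** * The switch as an exchange of roles between the pieces *)

Section Switch.
Variables (X : graph V) (r : V) (Y Z : graph V) (s : V).
Hypothesis br : bridgeable X r Y Z s.
Let Y' := relabel (tperm r s) Y.

Let gYZ : glued Y Z s. Proof. by case: br. Qed.
Let gY : is_graph Y. Proof. by case: gYZ. Qed.
Let sY : s \in verts Y. Proof. by case: (glued_root gYZ). Qed.
Let sZ : s \in verts Z. Proof. by case: (glued_root gYZ). Qed.
Let rX : r \in verts X. Proof. by case: br. Qed.
Let XY x : x \in verts X -> x \in verts Y = false.
Proof.
move=> xX; case: br => _ _ _ _ d; have := disjointFr d xX.
by rewrite inE => /norP[/negbTE].
Qed.
Let XZ x : x \in verts X -> x \in verts Z = false.
Proof.
move=> xX; case: br => _ _ _ _ d; have := disjointFr d xX.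
by rewrite inE => /norP[_ /negbTE].
Qed.

(** After the switch [Z] is alone on its side of the bridge, while the renamed branch meets [X] at
    [r]. *)
Lemma switch_bridgeable : bridgeable Z s Y' X r.
Proof.
have [gX cX _ [_ gZ cY cZ _] _] := br; split=> //.
  split=> //; [exact: relabel_is_graph|exact: relabel_connected|].
  apply/setP => x; rewrite in_setI in_set1 relabel_tperm_vert.
  have [->|xr] := eqVneq x r; first by rewrite tpermL sY rX.
  have [->|xs] := eqVneq x s; first by rewrite tpermR XY.
  rewrite tpermD 1?eq_sym //; case xX : (x \in verts X); rewrite ?andbF //.
  by rewrite XY.
apply/pred0P => x /=; rewrite in_setU relabel_tperm_vert; apply/negP => /andP[xZ].
have [E|xr] := eqVneq x r; first by rewrite E XZ in xZ.
have [->|xs] := eqVneq x s.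
  by rewrite tpermR XY //= => /XY; rewrite sY.
rewrite tpermD 1?eq_sym // => /orP[xY|/XZ]; last by rewrite xZ.
by have := glued_vert gYZ x; rewrite xY xZ (negbTE xs).
Qed.

(** Since [r] is not in [Y], the transposition moves only the edges at [s], which it turns into
    edges at [r]. *)
Lemma relabel_edges e : (e \in edges Y') =
  (e \in edges Y) && (e \notin [set [set s; y] | y in nbrs Y s])
  || (e \in [set [set r; y] | y in nbrs Y s]).
Proof.
have ends x : x \in verts Y -> x != r by apply: contraTneq => ->; rewrite XY.
apply/idP/orP => [/imsetP[f fY ->]|[/andP[eY nA]|/imsetP[y]]].
- have [x [y [E xy xY yY]]] := graph_edgeE gY fY.
  wlog ys : x y E xy xY yY / y != s.
    move=> W; have [yE|] := eqVneq y s; last exact: (W x y).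
    by apply: (W y x _ _ yY xY _); [rewrite setUC|rewrite eq_sym|rewrite -yE].
  have [xE|xs] := eqVneq x s.
    right; apply/imsetP; exists y; first by rewrite inE /adj -xE -E.
    by rewrite E imsetU !imset_set1 xE tpermR tpermD 1?eq_sym // ends.
  left; have -> : tperm r s @: f = f.
    by rewrite E imsetU !imset_set1 !tpermD 1?eq_sym // ends.
  rewrite fY /=; apply/imsetP => -[z _ fE].
  have : s \in f by rewrite fE !inE eqxx.
  by rewrite E !inE eq_sym (negbTE xs) eq_sym (negbTE ys).
- have [x [y [E xy xY yY]]] := graph_edgeE gY eY.
  have off z t : e = [set z; t] -> z != s.
    move=> zE; apply: contra nA => /eqP zs; apply/imsetP; exists t; rewrite -?zs //.
    by rewrite inE /adj -zE.
  apply/imsetP; exists e => //; rewrite {2}E imsetU !imset_set1 !tpermD //; rewrite 1?eq_sym ?ends //.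
    by apply: (off y x); rewrite E setUC.
  exact: (off x y).
- rewrite inE => sy ->; have [ys _ yY] := adj_verts gY sy.
  apply/imsetP; exists [set s; y] => //.
  by rewrite imsetU !imset_set1 tpermR tpermD 1?eq_sym // ?ends // eq_sym.
Qed.

Lemma switch_bridged :
  switch (bridged X r Y Z s) s r (nbrs Y s) = bridged Z s Y' X r.
Proof.
apply: injective_projections; apply/setP => x.
  rewrite -[LHS]/(x \in verts (bridged X r Y Z s)) -[RHS]/(x \in verts (bridged Z s Y' X r)).
  rewrite (verts_bridged br) (verts_bridged switch_bridgeable) relabel_tperm_vert.
  have [->|xr] := eqVneq x r; first by rewrite tpermL rX sY !orbT.
  have [->|xs] := eqVneq x s; first by rewrite sY sZ !orbT.
  by rewrite tpermD 1?eq_sym //; case: (x \in verts X); case: (x \in verts Y); case: (x \in verts Z).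
have gX : is_graph X by case: br.
(* The deleted edges belong to [Y] alone, so deleting them leaves [X], the bridge and [Z] intact. *)
have disjA : x \in [set [set s; y] | y in nbrs Y s] ->
    [/\ x \notin edges X, x != [set r; s] & x \notin edges Z].
  case/imsetP => y; rewrite inE => sy ->; have [ys _ yY] := adj_verts gY sy; split.
  - by apply/negP => /(adj_verts gX)[_ /XY]; rewrite sY.
  - apply/eqP => /setP/(_ y); rewrite !inE eqxx orbT [y == s]eq_sym (negbTE ys) orbF => /esym/eqP E.
    by have := XY rX; rewrite -E yY.
  - by rewrite (disjointFr (glued_edges_disjoint gYZ)).
rewrite !(in_setU, in_setD) relabel_edges !in_set1 (setUC [set s]).
case: (boolP (x \in [set [set s; y] | y in nbrs Y s])) => [/disjA[/negbTE -> /negbTE -> /negbTE ->]|_].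
  by rewrite /= andbF orbF.
by case: (x \in edges X); case: (x == _); case: (x \in edges Y); case: (x \in edges Z);
  rewrite /= ?orbT ?orbF.
Qed.

End Switch.
End Structure.

Theorem theorem3p1 (V : finType) (T T0 T1 P P0 T' : graph V)
    (u w v0 : V) (p p0 : seq V)
    (hT : is_tree T)
    (huw : adj T u w)
    (hT0 : component (del_edge T u w) u = T0)
    (hT1 : is_tree T1)
    (hw1 : w \in verts T1)
    (hp : is_path T w p)
    (hv0 : last w p = v0)
    (hP : P = path_graph w p)
    (hpendent : 0 < size_of P -> is_pendent_path T w p)
    (hT1P : component (del_edge T u w) w = gunion T1 P)
    (hcap : verts T1 :&: verts P = [set w])
    (hm : 0 <= size_of P < ecc 2 u T0)
    (hT' : T' = switch T w u (nbrs T1 w))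
    (hp0 : is_longest_path_from T0 u p0)
    (hP0 : P0 = path_graph u p0) :
  let cond := [/\ ecc_sub T0 P0 <= ecc 2 w P < ecc 2 u T0
                & ecc 2 w T1 <= ecc 2 w P] in
  (cond -> aecc 3 T' = aecc 3 T) /\
  (* strictness needs T1 nontrivial: if T1 is the single vertex w then T' = T *)
  (~ cond -> 1 < order_of T1 -> (aecc 3 T' < aecc 3 T)%R).
Proof.
have [gT cT aT] := hT; have [g1 c1 _] := hT1.
set D := del_edge T u w in hT0 hT1P.
have gD : is_graph D := is_graph_del_edge u w gT.
have g0 : is_graph T0 by rewrite -hT0; exact: component_is_graph.
have c0 : connected T0 by rewrite -hT0; exact: component_connected.
have a0 : acyclic T0.
  by apply: acyclic_sub aT => e; rewrite -hT0 inE => /andP[/setD1P[]].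
have u0 : u \in verts T0 by rewrite -hT0 inE connect0.
have /and3P[wT wp up] := hp.
have gP : is_graph P by rewrite hP; exact: path_graph_is_graph.
have cP : connected P by rewrite hP; exact: path_graph_connected.
have wP : w \in verts P by rewrite hP verts_path_graph mem_head.
have sP : subgraph P T by rewrite hP; exact: path_subgraph.
(* A vertex on both sides would connect [u] to [w] without the edge [uw], which is a bridge of the
   tree. *)
have br : bridgeable T0 u T1 P w.
  split=> //; rewrite -[_ :|: _]/(verts (gunion T1 P)) -hT1P -hT0.
  apply/pred0P => x; apply/negP => /andP[]; rewrite !inE => ux wx.
  have /negP := acyclic_bridge gT aT huw; apply.
  by apply: connect_trans ux _; rewrite connect_adjC.
have TE : T = bridged T0 u T1 P w by rewrite (edge_split gT cT huw) -/D hT0 hT1P.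
have T'E : T' = bridged P w (relabel (tperm u w) T1) T0 u.
  by rewrite hT' {1}TE switch_bridged.
have br' := switch_bridgeable br; have brC := bridgeableC br; have brC' := bridgeableC br'.
(* The commuted descriptions let the lemmas on [Y] speak about the piece in position [Z]. *)
have TC : T = bridged T0 u P T1 w by rewrite bridgedC.
have TC' : T' = bridged P w T0 (relabel (tperm u w) T1) u by rewrite bridgedC.
have vT' : verts T' = verts T by rewrite hT'.
have gT' : is_graph T' by rewrite T'E; exact: bridged_is_graph br'.
have cT' : connected T' by rewrite T'E; exact: bridged_connected br'.
have [_ _ _ _ dis] := br.
(* Counting [w] with [P] makes [tperm u w] the identity on [V1]. *)
set V1 := verts T1 :\ w.
have memT x : (x \in verts T) = [|| x \in verts T0, x \in verts T1 | x \in verts P].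
  by rewrite {1}TE (verts_bridged br).
have loc x : x \in verts T -> [\/ x \in verts T0, x \in V1 | x \in verts P].
  rewrite memT /V1 in_setD1; have [->|] := eqVneq x w; first by constructor 3.
  by move=> _ /or3P[]; [constructor 1|constructor 2|constructor 3].
have sub0 : {subset verts T0 <= verts T} by move=> x; rewrite memT => ->.
have sub1 : {subset V1 <= verts T} by move=> x /setD1P[_]; rewrite memT => ->; rewrite orbT.
have subP : {subset verts P <= verts T} by move=> x; rewrite memT => ->; rewrite !orbT.
have dis0 x : x \in verts T1 :|: verts P -> x \notin verts T0.
  by move=> xW; rewrite (disjointFl dis).
have dis10 x : x \in V1 -> x \notin verts T0.
  by move=> /setD1P[_ x1]; apply: dis0; rewrite inE x1.
have disP0 x : x \in verts P -> x \notin verts T0.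
  by move=> xP; apply: dis0; rewrite inE xP orbT.
have in1 x : x \in V1 -> x \in verts T1 by move=> /setD1P[].
have ne1 x : x \in V1 -> x != w by move=> /setD1P[].
have neu x : x \in V1 -> x != u.
  by move=> /dis10; apply: contraNneq => ->.
have perm1 x : x \in V1 -> tperm u w x = x.
  by move=> x1; rewrite tpermD // eq_sym ?neu ?ne1.
have in1' x : x \in V1 -> x \in verts (relabel (tperm u w) T1).
  by move=> x1; rewrite relabel_tperm_vert perm1 // in1.
have rel1 x y : x \in V1 -> y \in V1 ->
    steiner3 (relabel (tperm u w) T1) u x y = steiner3 T1 w x y.
  move=> x1 y1; rewrite -[RHS](steiner3_relabel (tperm u w) g1 c1 hw1 (in1 _ x1) (in1 _ y1)).
  by rewrite tpermR !perm1.
have rel1s x y z : x \in V1 -> y \in V1 -> z \in V1 ->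
    steiner3 (relabel (tperm u w) T1) x y z = steiner3 T1 x y z.
  move=> x1 y1 z1.
  rewrite -[RHS](steiner3_relabel (tperm u w) g1 c1 (in1 _ x1) (in1 _ y1) (in1 _ z1)).
  by rewrite !perm1.
have aE : ecc 2 u T0 = size p0 := ecc2_longest g0 c0 hp0 a0.
have bE : size_of P = size p by rewrite hP size_path_graph.
(* With [size p < size p0], this and the next bound give [P] fewer vertices than [T0]. *)
have n0 : size p0 < #|verts T0| by have [/(is_path_size g0)] := hp0.
have nP : #|verts P| <= (size p).+1 by rewrite hP /= cardsE card_size.
(* [T0] has at least two vertices because [ecc 2 u T0] is positive, and [w] is a third one. *)
have n3 : 2 < order_of T.
  have : #|w |: verts T0| <= order_of T.
    apply: subset_leq_card; rewrite subUset sub1set wT; exact/subsetP.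
  rewrite cardsU1 disP0 //; move: hm n0; rewrite aE; clear; lia.
have n3' : 2 < order_of T' by rewrite /order_of vT'.
have fP_le x y z : x \in verts P -> y \in verts P -> z \in verts P ->
    steiner3 P x y z <= size_of P.
  move=> xP yP zP; apply: steiner_le => //; first exact: subgraph_refl.
  by rewrite !subUset !sub1set xP yP zP.
have v0P : v0 \in verts P by rewrite -hv0 hP verts_path_graph mem_last.
have fP_att : steiner3 P w v0 v0 = size_of P.
  apply/eqP; rewrite eqn_leq fP_le //= bE -hv0.
  by apply: (acyclic_path_steiner gT aT hp) => //; rewrite hv0.
have eccP : ecc 2 w P = size_of P.
  apply/eqP; rewrite eqn_leq -{2}fP_att steiner3_le_ecc2 // andbT.
  by have [x xP ->] := ecc2_attained gP wP; exact: fP_le.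
(* [T] and [T'] have the same vertices, so averages compare as sums do. *)
have sumE : (forall v, v \in verts T -> ecc 3 v T' = ecc 3 v T) -> aecc 3 T' = aecc 3 T.
  by move=> E; rewrite /aecc /order_of vT' (eq_bigr _ E).
have sumlt : \sum_(v in verts T) ecc 3 v T' < \sum_(v in verts T) ecc 3 v T ->
    (aecc 3 T' < aecc 3 T)%R.
  move=> lt; rewrite /aecc /order_of vT' Num.Theory.ltr_pM2r ?Num.Theory.ltr_nat //.
  by rewrite Num.Theory.invr_gt0 Num.Theory.ltr0n; apply: leq_trans n3.
have t12 G x y z := @steiner3C12 V G x y z.
have t23 G x y z := @steiner3C23 V G x y z.
have e000 x y z : x \in verts T0 -> y \in verts T0 -> z \in verts T0 ->
    steiner3 T' x y z = steiner3 T x y z.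
  by move=> *; rewrite TC' TE (steiner3_YYY brC') ?(steiner3_XXX br).
have e111 x y z : x \in V1 -> y \in V1 -> z \in V1 -> steiner3 T' x y z = steiner3 T x y z.
  by move=> *; rewrite T'E TE (steiner3_YYY br') ?(steiner3_YYY br) ?rel1s ?in1' ?in1.
have ePPP x y z : x \in verts P -> y \in verts P -> z \in verts P ->
    steiner3 T' x y z = steiner3 T x y z.
  by move=> *; rewrite T'E TC (steiner3_XXX br') ?(steiner3_YYY brC).
have e001 x y z : x \in verts T0 -> y \in verts T0 -> z \in V1 ->
    steiner3 T x y z = steiner3 T0 u x y + steiner3 T1 w z z + 1 /\
    steiner3 T' x y z = steiner3 T0 u x y + steiner3 T1 w z z.
  move=> x0 y0 z1; rewrite {1}TE (steiner3_XXY br) ?in1 // addn1 addnS.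
  by rewrite (t23 T') (t12 T') T'E (steiner3_YZZ br') ?in1' ?neu // rel1 // addnC.
have e00P x y z : x \in verts T0 -> y \in verts T0 -> z \in verts P ->
    steiner3 T x y z = steiner3 T0 u x y + steiner3 P w z z + 1 /\
    steiner3 T' x y z = steiner3 T0 u x y + steiner3 P w z z + 1.
  move=> x0 y0 zP; rewrite {1}TC (steiner3_XXY brC) // addn1 addnS.
  by rewrite (t23 T') (t12 T') TC' (steiner3_XYY brC') // addnS addnC.
have e011 x y z : x \in verts T0 -> y \in V1 -> z \in V1 ->
    steiner3 T x y z = steiner3 T0 u x x + steiner3 T1 w y z + 1 /\
    steiner3 T' x y z = steiner3 T0 u x x + steiner3 T1 w y z.
  move=> x0 y1 z1; rewrite {1}TE (steiner3_XYY br) ?in1 // addn1 addnS.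
  by rewrite (t12 T') (t23 T') T'E (steiner3_YYZ br') ?in1' ?neu // rel1 // addnC.
have e01P x y z : x \in verts T0 -> y \in V1 -> z \in verts P ->
    steiner3 T x y z = steiner3 T0 u x x + steiner3 T1 w y y + steiner3 P w z z + 1 /\
    steiner3 T' x y z = steiner3 T0 u x x + steiner3 T1 w y y + steiner3 P w z z + 1.
  move=> x0 y1 zP; rewrite {1}TE (steiner3_XYZ br) ?in1 // (steiner3C13 T').
  rewrite T'E (steiner3_XYZ br') ?in1' // rel1 //; clear; lia.
have e0PP x y z : x \in verts T0 -> y \in verts P -> z \in verts P ->
    steiner3 T x y z = steiner3 T0 u x x + steiner3 P w y z + 1 /\
    steiner3 T' x y z = steiner3 T0 u x x + steiner3 P w y z + 1.
  move=> x0 yP zP; rewrite {1}TC (steiner3_XYY brC) // addn1 addnS.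
  by rewrite (t12 T') (t23 T') TC' (steiner3_XXY brC') // addnS addnC.
have e11P x y z : x \in V1 -> y \in V1 -> z \in verts P ->
    steiner3 T x y z = steiner3 T1 w x y + steiner3 P w z z /\
    steiner3 T' x y z = steiner3 T1 w x y + steiner3 P w z z + 1.
  move=> x1 y1 zP; rewrite {1}TE (steiner3_YYZ br) ?in1 ?ne1 // addn1.
  by rewrite (t23 T') (t12 T') T'E (steiner3_XYY br') ?in1' // rel1 // addnS addnC.
have e1PP x y z : x \in V1 -> y \in verts P -> z \in verts P ->
    steiner3 T x y z = steiner3 T1 w x x + steiner3 P w y z /\
    steiner3 T' x y z = steiner3 T1 w x x + steiner3 P w y z + 1.
  move=> x1 yP zP; rewrite {1}TE (steiner3_YZZ br) ?in1 ?ne1 // addn1.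
  by rewrite (t12 T') (t23 T') T'E (steiner3_XXY br') ?in1' // rel1 // addnS addnC.
have f1_att y : y \in V1 -> exists2 x, x \in V1 & steiner3 T1 w x x = ecc 2 w T1.
  move=> y1; have [x x1 xE] := ecc2_attained g1 hw1.
  (* A maximum attained at [w] is 0, and then any vertex of [V1] attains it as well. *)
  have [xw|xw] := eqVneq x w; last by exists x => //; apply/setD1P.
  have := steiner3_le_ecc2 g1 c1 hw1 (in1 y y1).
  by rewrite xE xw steiner3_root_self // leqn0 => /eqP yE; exists y.
have f0_att : exists2 x, x \in verts T0 & steiner3 T0 u x x = ecc 2 u T0.
  by have [x ? ->] := ecc2_attained g0 u0; exists x.
have f0_le2 x y : x \in verts T0 -> y \in verts T0 ->
    steiner3 T0 u x y <= ecc 2 u T0 + ecc_sub T0 P0.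
  by rewrite aE hP0; exact: steiner3_longest_le.
have f0_att2 : exists x y, [/\ x \in verts T0, y \in verts T0
    & ecc 2 u T0 + ecc_sub T0 P0 <= steiner3 T0 u x y].
  by rewrite aE hP0; exact: steiner3_longest_attained.
have f1_sub x y z : x \in V1 -> y \in V1 -> z \in V1 ->
    steiner3 T x y z <= steiner3 T1 w x y + steiner3 T1 w z z.
  by move=> x1 y1 z1; rewrite TE (steiner3_YYY br) ?in1 //;
    exact: (steiner3_le_root g1 c1 hw1 (in1 _ x1) (in1 _ y1) (in1 _ z1)).
have f0_sub x y z : x \in verts T0 -> y \in verts T0 -> z \in verts T0 ->
    steiner3 T x y z <= steiner3 T0 u x x + steiner3 T0 u y z.
  move=> x0 y0 z0; rewrite TE (steiner3_XXX br) // steiner3C12 (t23 T0 y) addnC.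
  exact: steiner3_le_root.
have [eqE ltE] : (ecc_sub T0 P0 <= size_of P -> ecc 2 w T1 <= size_of P ->
      forall v, v \in verts T -> ecc 3 v T' = ecc 3 v T) /\
    (V1 != set0 -> ~~ ((ecc_sub T0 P0 <= size_of P) && (ecc 2 w T1 <= size_of P)) ->
      \sum_(v in verts T) ecc 3 v T' < \sum_(v in verts T) ecc 3 v T).
  apply: (@ecc_comparison V (verts T) (verts T0) V1 (verts P) (steiner3 T) (steiner3 T')
    (steiner3 T0 u) (steiner3 T1 w) (steiner3 P w) (fun v => ecc 3 v T) (fun v => ecc 3 v T')
    (ecc 2 u T0) (size_of P) (ecc 2 w T1) (ecc_sub T0 P0)) => //.
  - by move=> v x y; exact: steiner3_le_ecc3.
  - by move=> v x y; rewrite -vT'; exact: steiner3_le_ecc3.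
  - by move=> v; exact: ecc3_attained.
  - by move=> v; rewrite -vT'; exact: ecc3_attained.
  - by move=> x; exact: steiner3_le_ecc2.
  - by move=> x /in1; exact: steiner3_le_ecc2.
  - by move=> x y; exact: fP_le.
  - by exists v0.
  - by move=> x y; exact: steiner3_root_mono.
  - by move=> x y; exact: steiner3_root_subadd.
  - by move=> x y /in1 x1 /in1; exact: steiner3_root_subadd.
  - exact: u0.
  - exact: steiner3_root_self.
  - by move=> x z x0 z0; rewrite TE (steiner3_XXX br).
  - by move: hm nP n0; rewrite aE bE; clear; lia.
move=> cond; split=> [[/andP[h1 _] h2]|ncond n1].
  by apply: sumE; apply: eqE; rewrite -eccP.
apply: sumlt; apply: ltE.
  by rewrite -card_gt0; move: n1; rewrite /order_of (cardsD1 w) hw1.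
(* The strict inequality in [cond] is supplied by [hm], so the failure of [cond] lies in one of the
   other two. *)
by apply/negP => /andP[h1 h2]; apply: ncond; rewrite /cond eccP h1.
Qed.
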